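(* Let $\mathcal M$ be an o-minimal structure in a language $\mathcal L$ with universe $M$, and $\mathcal N$ an expansion of $\mathcal M$ such that every open definable set is $\mathcal L$-definable and $\mathcal N$ admits a dimension function $\dim$ compatible with $\mathcal M$. Let $G=\langle G,\cdot,1\rangle$ be a strongly large definable group with $G\subseteq M^n$ and $\dim G=k$. Then there are - $\mathcal L$-definable sets $X\subseteq M^m$ and $Z\subseteq X^2$ with $\dim(X^2\setminus Z)<2k$, - a definable injective map $h:X\to G$ with $\dim(G\setminus h(X))<k$, and - an $\mathcal L$-definable map $F:X^2\to X$ such that $h(x)\cdot h(y)=h(F(x,y))$ for every $(x,y)\in Z$.
   Context: ''Definable'' means definable in $\mathcal N$ with parameters; ''$\mathcal L$-definable'' means definable in $\mathcal M$ with parameters. A dimension function compatible with $\mathcal M$ is a map $\dim$ from definable sets to $\{-\infty\}\cup\mathbb N$ such that for all definable $X,Y\subseteq M^n$, $a\in M$: (D1) $\dim\{a\}=0$, $\dim M=1$, $\dim X=-\infty$ iff $X=\emptyset$; (D2) $\dim(X\cup Y)=\max\{\dim X,\dim Y\}$; (D3) for a definable family $\{X_t\}_{t\in I}$ of pairwise disjoint sets: (a) each $\{t\in I:\dim X_t=d\}$ is definable; (b) if all $X_t$ have dimension $k$ then $\dim\bigcup_t X_t=\dim I+k$; (D4) definable bijections preserve $\dim$; (D5) on $\mathcal L$-definable sets $\dim$ is the o-minimal dimension; (D6) every definable $f:M^n\to M$ agrees with an $\mathcal L$-definable $F:M^n\to M$ outside a definable set of dimension $<n$. $cl$ denotes topological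 closure; a definable set $X$ is strongly large if $\dim X=\dim cl(X)$; a definable group is strongly large if its universe is. *)

(* Defs.v *)
From mathcomp Require Import all_boot.
From Stdlib Require List.

Set Implicit Arguments.
Unset Strict Implicit.
Unset Printing Implicit Defensive.

Definition pset (M : Type) (n : nat) := ('I_n -> M) -> Prop.

Definition cat_tup (M : Type) (m n : nat) (x : 'I_m -> M) (y : 'I_n -> M)
  : 'I_(m + n) -> M :=
  fun i => match split i with inl a => x a | inr b => y b end.

(* A "structure" on M in the sense of van den Dries (Tame topology, Ch.1):
   for each n a Boolean algebra S n of subsets of M^n, closed under
   preimages and images along coordinate maps (this yields products with M,
   permutations of coordinates and projections), containing the diagonal
   of M^2, and containing all singletons of M (= definable with
   parameters). *)
Definition is_structure (M : Type) (S : forall n, pset M n -> Prop) : Prop :=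
  (forall n, S n (fun _ => False)) /\
  (forall n (A : pset M n), S n A -> S n (fun x => ~ A x)) /\
  (forall n (A B : pset M n), S n A -> S n B -> S n (fun x => A x /\ B x)) /\
  (forall m n (f : 'I_m -> 'I_n) (A : pset M m),
      S m A -> S n (fun x => A (fun i => x (f i)))) /\
  (forall m n (f : 'I_m -> 'I_n) (A : pset M n),
      S n A -> S m (fun y => exists x, A x /\ forall i, x (f i) = y i)) /\
  S 2 (fun x => x ord0 = x ord_max) /\
  (forall a : M, S 1 (fun x => x ord0 = a)).

Definition dlo (M : Type) (lt : M -> M -> Prop) : Prop :=
  [/\ (forall x, ~ lt x x),
      (forall x y z, lt x y -> lt y z -> lt x z),
      (forall x y, lt x y \/ x = y \/ lt y x),
      (forall x y, lt x y -> exists z, lt x z /\ lt z y) &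
      (forall x, (exists y, lt y x) /\ (exists y, lt x y))].

(* open interval with endpoints in M u {-oo,+oo} (None = infinite) *)
Definition in_interval (M : Type) (lt : M -> M -> Prop)
  (iv : option M * option M) (x : M) : Prop :=
  (match iv.1 with Some a => lt a x | None => True end) /\
  (match iv.2 with Some b => lt x b | None => True end).

Definition o_minimal (M : Type) (lt : M -> M -> Prop)
  (S : forall n, pset M n -> Prop) : Prop :=
  [/\ dlo lt, is_structure S,
      S 2 (fun x => lt (x ord0) (x ord_max)) &
      (forall A : pset M 1, S 1 A ->
         exists (pts : list M) (ivs : list (option M * option M)),
           forall x : M, A (fun _ => x) <->
             (List.In x pts \/ exists iv, List.In iv ivs /\ in_interval lt iv x))].

Definition in_box (M : Type) (lt : M -> M -> Prop) n (a b x : 'I_n -> M) :=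
  forall i, lt (a i) (x i) /\ lt (x i) (b i).

Definition is_open (M : Type) (lt : M -> M -> Prop) n (U : pset M n) : Prop :=
  forall x, U x -> exists a b, in_box lt a b x /\
                               forall y, in_box lt a b y -> U y.

Definition cl (M : Type) (lt : M -> M -> Prop) n (X : pset M n)
  : pset M n :=
  fun x => forall a b, in_box lt a b x -> exists y, X y /\ in_box lt a b y.

Definition has_interior (M : Type) (lt : M -> M -> Prop) n (X : pset M n) :=
  exists U : pset M n, is_open lt U /\ (exists x, U x) /\ forall x, U x -> X x.

Definition proj_set (M : Type) m n (f : 'I_m -> 'I_n) (X : pset M n)
  : pset M m :=
  fun y => exists x, X x /\ forall i, x (f i) = y i.

(* ---------- dimensions in {-oo} u N, -oo = None ---------- *)

Definition dlt (d : option nat) (k : nat) : Prop :=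
  match d with None => True | Some a => (a < k)%N end.

Definition dmax (d e : option nat) : option nat :=
  match d, e with
  | None, _ => e
  | _, None => d
  | Some a, Some b => Some (maxn a b)
  end.

Definition dadd (d : option nat) (k : nat) : option nat :=
  match d with None => None | Some a => Some (a + k)%N end.

Definition is_odim (M : Type) (lt : M -> M -> Prop) n (X : pset M n)
  (d : option nat) : Prop :=
  match d with
  | None => forall x, ~ X x
  | Some e =>
      (exists f : 'I_e -> 'I_n, (forall i j : 'I__, (i < j)%N -> (f i < f j)%N) /\
                                has_interior lt (proj_set f X)) /\
      (forall e' (f : 'I_e' -> 'I_n), (forall i j : 'I__, (i < j)%N -> (f i < f j)%N) ->
                                has_interior lt (proj_set f X) -> (e' <= e)%N)
  end.

Definition graph_on (M : Type) n m (X : pset M n) (f : ('I_n -> M) -> ('I_m -> M))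
  : pset M (n + m) :=
  fun z => exists x, X x /\ z = cat_tup x (f x).

(* A dimension function on the N-definable sets (SN) compatible with the
   o-minimal structure (lt, SL); axioms (D1)-(D6). *)
Definition dim_compatible (M : Type) (lt : M -> M -> Prop)
  (SL SN : forall n, pset M n -> Prop)
  (dim : forall n, pset M n -> option nat) : Prop :=
  [/\
      (forall a : M, dim 1 (fun x => x ord0 = a) = Some 0%N)
      /\ dim 1 (fun _ => True) = Some 1%N
      /\ (forall n (X : pset M n), SN n X -> (dim n X = None <-> forall x, ~ X x)),
      (forall n (X Y : pset M n), SN n X -> SN n Y ->
         dim n (fun x => X x \/ Y x) = dmax (dim n X) (dim n Y)),
      (* D3: definable family {X_t}_{t in I}, X_t = fibre of X over t *)
      (forall p n (I : pset M p) (X : pset M (p + n)), SN p I -> SN (p + n) X ->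
         (forall t t' y, I t -> I t' -> X (cat_tup t y) -> X (cat_tup t' y) -> t = t') ->
         (forall d, SN p (fun t => I t /\ dim n (fun y => X (cat_tup t y)) = d))
         /\ (forall k, (forall t, I t -> dim n (fun y => X (cat_tup t y)) = Some k) ->
               dim n (fun y => exists t, I t /\ X (cat_tup t y)) = dadd (dim p I) k)),
      (forall n m (X : pset M n) (Y : pset M m) (f : ('I_n -> M) -> ('I_m -> M)),
         SN (n + m) (graph_on X f) ->
         (forall x, X x -> Y (f x)) ->
         (forall x x', X x -> X x' -> f x = f x' -> x = x') ->
         (forall y, Y y -> exists x, X x /\ f x = y) ->
         dim n X = dim m Y) &
      (
      (forall n (X : pset M n), SL n X -> is_odim lt X (dim n X)) /\
      (forall n (f : ('I_n -> M) -> M),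
         SN (n + 1) (graph_on (fun _ => True) (fun x => fun _ : 'I_1 => f x)) ->
         exists (F : ('I_n -> M) -> M) (E : pset M n),
           SL (n + 1) (graph_on (fun _ => True) (fun x => fun _ : 'I_1 => F x)) /\
           SN n E /\ dlt (dim n E) n /\
           forall x, ~ E x -> f x = F x))].

(* Main.v *)
(* The closure [C] of [G] has an open complement, hence is [L]-definable, and dim C = k.
   The key step is to extend (D6) from [M^n] to [L]-definable sets such as [C] and
   [C x C]. By induction on the coordinates, [C] is a finite union of pieces onto which
   some [M^N] maps [L]-definably with all fibres of the expected dimension; a definable
   function on a piece is pulled back to [M^N], replaced there by an [L]-definable one,
   and pushed forward again by taking the value assumed on a large part of each fibre.
   Neither cell decomposition nor uniform finiteness is needed.

   Thus there are an [L]-definable [X0] equal to [G] and an [L]-definable [p] equal to the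
   multiplication, both up to sets of smaller dimension. Since [X0] may contain points
   outside [G], a point [x] is mapped to the [g] in [G], if any, such that
   [p (x, u) = g u] for generic [u]. An associativity condition on [p], which is
   [L]-definable, singles out points that have such a [g], and the points sharing their
   [g] with another one form a small [L]-definable set, which is discarded. *)
Require Import Defs.
From mathcomp Require Import all_boot.
From Stdlib Require Import Classical ClassicalEpsilon FunctionalExtensionality.
From Stdlib Require Import PropExtensionality.

Set Implicit Arguments.
Unset Strict Implicit.
Unset Printing Implicit Defensive.

(** * Definable sets and maps *)

Lemma pset_ext (M : Type) n (A B : pset M n) : (forall x, A x <-> B x) -> A = B.
Proof.
by move=> AB; apply: functional_extensionality => x;
  apply: propositional_extensionality.
Qed.

Definition lpart (M : Type) m n (z : 'I_(m + n) -> M) : 'I_m -> M :=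
  fun i => z (lshift n i).

Definition rpart (M : Type) m n (z : 'I_(m + n) -> M) : 'I_n -> M :=
  fun i => z (rshift m i).

Lemma lpart_cat (M : Type) m n (x : 'I_m -> M) (y : 'I_n -> M) :
  lpart (cat_tup x y) = x.
Proof.
by apply: functional_extensionality => i; rewrite /lpart /cat_tup (unsplitK (inl i)).
Qed.

Lemma rpart_cat (M : Type) m n (x : 'I_m -> M) (y : 'I_n -> M) :
  rpart (cat_tup x y) = y.
Proof.
by apply: functional_extensionality => i; rewrite /rpart /cat_tup (unsplitK (inr i)).
Qed.

Lemma cat_parts (M : Type) m n (z : 'I_(m + n) -> M) :
  cat_tup (lpart z) (rpart z) = z.
Proof.
apply: functional_extensionality => i; rewrite /cat_tup -{2}(splitK i).
by case: (split i).
Qed.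

Lemma cat_inj (M : Type) m n (x x' : 'I_m -> M) (y y' : 'I_n -> M) :
  cat_tup x y = cat_tup x' y' -> x = x' /\ y = y'.
Proof.
by move=> e; split; [rewrite -(lpart_cat x y) e lpart_cat
                    |rewrite -(rpart_cat x y) e rpart_cat].
Qed.

Definition cond (T : Type) (P : Prop) (a b : T) : T :=
  if excluded_middle_informative P then a else b.

Lemma condT (T : Type) (P : Prop) (a b : T) : P -> cond P a b = a.
Proof. by rewrite /cond; case: excluded_middle_informative. Qed.

Lemma condF (T : Type) (P : Prop) (a b : T) : ~ P -> cond P a b = b.
Proof. by rewrite /cond; case: excluded_middle_informative. Qed.

(** Coordinate selections are the maps that the axioms of a structure allow to be substituted
    directly; other definable maps are reduced to them by naming their value with a quantifier. *)
Definition sel (M : Type) n m (t : ('I_n -> M) -> ('I_m -> M)) :=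
  exists f : 'I_m -> 'I_n, forall x, t x = fun i => x (f i).

(** Definable maps are total, so that they compose without conditions on domains; a partial map
    first receives a default value. *)
Definition dmap (M : Type) (S : forall n, pset M n -> Prop) n m
    (t : ('I_n -> M) -> ('I_m -> M)) :=
  S (n + m)%N (fun z => rpart z = t (lpart z)).

Definition dfun (M : Type) (S : forall n, pset M n -> Prop) n
    (c : ('I_n -> M) -> M) :=
  dmap S (fun x (_ : 'I_1) => c x).

(** Strict upper bounds need no separate case for the empty set, and the bound 0 expresses
    emptiness. *)
Definition small (M : Type) (dim : forall n, pset M n -> option nat) n
    (X : pset M n) (k : nat) :=
  dlt (dim n X) k.

(** The structure is a parameter because both structures have this property, for different
    reasons. *)
Definition sm_definable (M : Type) (S : forall n, pset M n -> Prop)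
    (dim : forall n, pset M n -> option nat) :=
  forall n m (A : ('I_n -> M) -> pset M m) k,
    S (n + m)%N (fun z => A (lpart z) (rpart z)) -> S n (fun x => small dim (A x) k).

Lemma choose_fun (A B : Type) (R : A -> B -> Prop) :
  (forall x, exists y, R x y) -> exists f, forall x, R x (f x).
Proof.
move=> h; exists (fun x => proj1_sig (constructive_indefinite_description _ (h x))) => x.
exact: proj2_sig.
Qed.

Section Definability.

Context (M : Type) (S : forall n, pset M n -> Prop) (HS : is_structure S).

Lemma def_ext n (A B : pset M n) : (forall x, A x <-> B x) -> S A -> S B.
Proof. by move=> /pset_ext ->. Qed.

Lemma def_false n : S (fun _ : 'I_n -> M => False).
Proof. by case: HS. Qed.

Lemma def_not n (A : pset M n) : S A -> S (fun x => ~ A x).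
Proof. by case: HS => _ [H _]; apply: H. Qed.

Lemma def_and n (A B : pset M n) : S A -> S B -> S (fun x => A x /\ B x).
Proof. by case: HS => _ [_ [H _]]; apply: H. Qed.

Lemma def_or n (A B : pset M n) : S A -> S B -> S (fun x => A x \/ B x).
Proof.
move=> hA hB; apply: (def_ext (A := fun x => ~ (~ A x /\ ~ B x))); first by move=> x; tauto.
by apply: def_not; apply: def_and; apply: def_not.
Qed.

Lemma def_imp n (A B : pset M n) : S A -> S B -> S (fun x => A x -> B x).
Proof.
move=> hA hB; apply: (def_ext (A := fun x => ~ A x \/ B x)); first by move=> x; tauto.
by apply: def_or => //; apply: def_not.
Qed.

Lemma def_const n (P : Prop) : S (fun _ : 'I_n -> M => P).
Proof.
case: (classic P) => hP.
  apply: (def_ext (A := fun x => ~ False)); first by move=> x; tauto.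
  by apply: def_not; apply: def_false.
by apply: (def_ext (A := fun x => False)); [move=> x; tauto | apply: def_false].
Qed.

Lemma def_fall n (I : finType) (P : ('I_n -> M) -> I -> Prop) :
  (forall i, S (fun x => P x i)) -> S (fun x => forall i, P x i).
Proof.
move=> hP.
have H (s : seq I) : S (fun x => forall i, i \in s -> P x i).
  elim: s => [|j s IH].
    by apply: (def_ext (A := fun=> True)); [move=> x; split | apply: def_const].
  apply: (def_ext (A := fun x => P x j /\ forall i, i \in s -> P x i)); last exact: def_and.
  move=> x; split.
    by move=> [hj hs] i; rewrite inE => /orP[/eqP-> //|]; apply: hs.
  by move=> h; split=> [|i hi]; apply: h; rewrite inE ?eqxx // hi orbT.
apply: def_ext (H (enum I)) => x; split=> h i => //.
by apply: h; rewrite mem_enum.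
Qed.

Lemma def_fex n (I : finType) (P : ('I_n -> M) -> I -> Prop) :
  (forall i, S (fun x => P x i)) -> S (fun x => exists i, P x i).
Proof.
move=> hP; apply: (def_ext (A := fun x => ~ forall i, ~ P x i)).
  by move=> x; split=> [/not_all_not_ex|[i hi] h] //; apply: (h i).
by apply: def_not; apply: def_fall => i; apply: def_not.
Qed.

Lemma def_sel n m (A : pset M m) (t : ('I_n -> M) -> 'I_m -> M) :
  S A -> sel t -> S (fun x => A (t x)).
Proof.
case: HS => _ [_ [_ [H _]]] hA [f hf].
by apply: (def_ext _ (H _ _ f _ hA)) => x; rewrite hf.
Qed.

Lemma def_ex n m (A : ('I_n -> M) -> ('I_m -> M) -> Prop) :
  S (fun z => A (lpart z) (rpart z)) -> S (fun x => exists y, A x y).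
Proof.
case: HS => _ [_ [_ [_ [H _]]]] hA.
apply: (def_ext _ (H _ _ (lshift m) _ hA)) => x; split.
  move=> [z [hz e]]; exists (rpart z); suff -> : x = lpart z by [].
  by apply: functional_extensionality => i; rewrite -e.
move=> [y hy]; exists (cat_tup x y); rewrite lpart_cat rpart_cat; split=> // i.
by rewrite -[LHS]/(lpart (cat_tup x y) i) lpart_cat.
Qed.

Lemma def_all n m (A : ('I_n -> M) -> ('I_m -> M) -> Prop) :
  S (fun z => A (lpart z) (rpart z)) -> S (fun x => forall y, A x y).
Proof.
move=> hA; apply: (def_ext (A := fun x => ~ exists y, ~ A x y)).
  by move=> x; split=> [h y|h [y]]; [apply: NNPP => hn; apply: h; exists y | apply].
by apply: def_not; apply: def_ex; apply: def_not.
Qed.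

Lemma def_ex1 n (A : ('I_n -> M) -> M -> Prop) :
  S (fun z : 'I_(n + 1) -> M => A (lpart z) (rpart z ord0)) ->
  S (fun x => exists y, A x y).
Proof.
move=> hA; apply: (def_ext _ (def_ex (A := fun x (y : 'I_1 -> M) => A x (y ord0)) hA)) => x.
by split=> [[y hy]|[y hy]]; [exists (y ord0) | exists (fun=> y)].
Qed.

Lemma def_all1 n (A : ('I_n -> M) -> M -> Prop) :
  S (fun z : 'I_(n + 1) -> M => A (lpart z) (rpart z ord0)) ->
  S (fun x => forall y, A x y).
Proof.
move=> hA; apply: (def_ext _ (def_all (A := fun x (y : 'I_1 -> M) => A x (y ord0)) hA)) => x.
by split=> h y; [exact: (h (fun=> y)) | exact: h].
Qed.

Lemma def_coord_eq n (i j : 'I_n) : S (fun x : 'I_n -> M => x i = x j).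
Proof.
case: HS => _ [_ [_ [_ [_ [H _]]]]].
by apply: (def_sel (t := fun x (a : 'I_2) => x (if a == ord0 then i else j)) H);
  eexists.
Qed.

Lemma def_coord_const n (i : 'I_n) (a : M) : S (fun x : 'I_n -> M => x i = a).
Proof.
case: HS => _ [_ [_ [_ [_ [_ H]]]]].
by apply: (def_sel (t := fun x (_ : 'I_1) => x i) (H a)); exists (fun=> i).
Qed.

Lemma sel_id n : sel (fun x : 'I_n -> M => x).
Proof. by exists id. Qed.

Lemma sel_l n m p (t : ('I_p -> M) -> ('I_(n + m) -> M)) :
  sel t -> sel (fun x => lpart (t x)).
Proof. by move=> [f hf]; exists (fun i => f (lshift m i)) => x; rewrite hf. Qed.

Lemma sel_r n m p (t : ('I_p -> M) -> ('I_(n + m) -> M)) :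
  sel t -> sel (fun x => rpart (t x)).
Proof. by move=> [f hf]; exists (fun i => f (rshift n i)) => x; rewrite hf. Qed.

Lemma sel_cat n m p (t : ('I_p -> M) -> ('I_n -> M)) (s : ('I_p -> M) -> ('I_m -> M)) :
  sel t -> sel s -> sel (fun x => cat_tup (t x) (s x)).
Proof.
move=> [f hf] [g hg].
exists (fun i => match split i with inl a => f a | inr b => g b end) => x.
by rewrite hf hg; apply: functional_extensionality => i; rewrite /cat_tup; case: (split i).
Qed.

Ltac sel_tac :=
  lazymatch goal with
  | |- sel (fun x => x) => exact: sel_id
  | |- sel (@lpart _ _ _) => apply: (sel_l (t := fun x => x)); sel_tac
  | |- sel (@rpart _ _ _) => apply: (sel_r (t := fun x => x)); sel_tac
  | |- sel (fun x => lpart (@?t x)) => apply: (sel_l (t := t)); sel_tac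
  | |- sel (fun x => rpart (@?t x)) => apply: (sel_r (t := t)); sel_tac
  end.

Lemma def_eq_sel n m (t s : ('I_n -> M) -> ('I_m -> M)) :
  sel t -> sel s -> S (fun x => t x = s x).
Proof.
move=> [f hf] [g hg].
apply: (def_ext (A := fun x => forall i, x (f i) = x (g i))).
  move=> x; rewrite hf hg; split=> [h|h i]; first exact: functional_extensionality.
  exact: (f_equal (fun k => k i) h).
by apply: def_fall => i; apply: def_coord_eq.
Qed.

Lemma dmap_sel n m (t : ('I_n -> M) -> ('I_m -> M)) : sel t -> dmap S t.
Proof.
move=> [f hf]; apply: def_eq_sel; first by sel_tac.
by exists (fun i => lshift m (f i)) => x; rewrite hf.
Qed.

Lemma def_graph n m p (t : ('I_n -> M) -> ('I_m -> M))
    (u : ('I_p -> M) -> ('I_n -> M)) (v : ('I_p -> M) -> ('I_m -> M)) :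
  dmap S t -> sel u -> sel v -> S (fun x => v x = t (u x)).
Proof.
move=> ht hu hv; apply: (def_ext _ (def_sel ht (sel_cat hu hv))) => x.
by rewrite lpart_cat rpart_cat.
Qed.

Lemma dmap_comp n m p (t : ('I_n -> M) -> ('I_m -> M)) (s : ('I_m -> M) -> ('I_p -> M)) :
  dmap S s -> dmap S t -> dmap S (fun x => s (t x)).
Proof.
move=> hs ht.
apply: (def_ext (A := fun z => exists y, y = t (lpart z) /\ rpart z = s y)).
  by move=> z; split=> [[y [-> ->]] //|->]; exists (t (lpart z)).
apply: def_ex; apply: def_and; apply: def_graph => //.
all: sel_tac.
Qed.

Lemma def_atom n m (A : pset M m) (t : ('I_n -> M) -> ('I_m -> M)) :
  S A -> dmap S t -> S (fun x => A (t x)).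
Proof.
move=> hA ht.
apply: (def_ext (A := fun z => exists y, y = t z /\ A y)).
  by move=> z; split=> [[y [->]] //|h]; exists (t z).
apply: def_ex; apply: def_and; last by apply: def_sel => //; sel_tac.
by apply: def_graph => //; sel_tac.
Qed.

Lemma dmap_id n : dmap S (fun x : 'I_n -> M => x).
Proof. by apply: dmap_sel; apply: sel_id. Qed.

Lemma dmap_l n m p (t : ('I_p -> M) -> ('I_(n + m) -> M)) :
  dmap S t -> dmap S (fun x => lpart (t x)).
Proof.
by apply: (dmap_comp (s := fun z => lpart z)); apply: dmap_sel; sel_tac.
Qed.

Lemma dmap_r n m p (t : ('I_p -> M) -> ('I_(n + m) -> M)) :
  dmap S t -> dmap S (fun x => rpart (t x)).
Proof.
by apply: (dmap_comp (s := fun z => rpart z)); apply: dmap_sel; sel_tac.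
Qed.

Lemma dmap_cat n m p (t : ('I_p -> M) -> ('I_n -> M)) (s : ('I_p -> M) -> ('I_m -> M)) :
  dmap S t -> dmap S s -> dmap S (fun x => cat_tup (t x) (s x)).
Proof.
move=> ht hs.
apply: (def_ext (A := fun z => lpart (rpart z) = t (lpart z) /\ rpart (rpart z) = s (lpart z))).
  move=> z; split=> [[h1 h2]|->]; last by rewrite lpart_cat rpart_cat.
  by rewrite -(cat_parts (rpart z)) h1 h2.
apply: def_and; apply: def_graph => //.
all: sel_tac.
Qed.

Lemma dmap_const n m (a : 'I_m -> M) : dmap S (fun _ : 'I_n -> M => a).
Proof.
apply: (def_ext (A := fun z : 'I_(n + m) -> M => forall i, z (rshift n i) = a i)).
  move=> z; split=> [h|h i]; first exact: functional_extensionality.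
  exact: (f_equal (fun k => k i) h).
by apply: def_fall => i; apply: def_coord_const.
Qed.

Lemma def_eq n m (t s : ('I_n -> M) -> ('I_m -> M)) :
  dmap S t -> dmap S s -> S (fun x => t x = s x).
Proof.
move=> ht hs.
apply: (def_ext (A := fun x => lpart (cat_tup (t x) (s x)) = rpart (cat_tup (t x) (s x)))).
  by move=> x; rewrite lpart_cat rpart_cat.
apply: (def_atom (A := fun z => lpart z = rpart z)); last exact: dmap_cat.
by apply: def_eq_sel; sel_tac.
Qed.

Lemma dfun_coord n m (t : ('I_n -> M) -> ('I_m -> M)) i :
  dmap S t -> dfun S (fun x => t x i).
Proof.
by apply: (dmap_comp (s := fun y (_ : 'I_1) => y i)); apply: dmap_sel; exists (fun=> i).
Qed.

Lemma dfun_const n (a : M) : dfun S (fun _ : 'I_n -> M => a).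
Proof. exact: dmap_const. Qed.

Lemma dmap_dfun n m (t : ('I_n -> M) -> ('I_m -> M)) :
  (forall i, dfun S (fun x => t x i)) -> dmap S t.
Proof.
move=> h.
apply: (def_ext (A := fun z : 'I_(n + m) -> M => forall i : 'I_m, (fun _ : 'I_1 => rpart z i) = fun _ => t (lpart z) i)).
  move=> z; split=> [H|-> //]; apply: functional_extensionality => i.
  exact: (f_equal (fun k => k ord0) (H i)).
apply: def_fall => i; apply: def_eq.
  by apply: (dfun_coord (t := fun z => rpart z)); apply: (dmap_r (t := id)); apply: dmap_id.
by apply: (dmap_comp (h i)); apply: (dmap_l (t := id)); apply: dmap_id.
Qed.

Lemma def_rel2 n (R : M -> M -> Prop) (c d : ('I_n -> M) -> M) :
  S (fun x : 'I_2 -> M => R (x ord0) (x ord_max)) -> dfun S c -> dfun S d ->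
  S (fun x => R (c x) (d x)).
Proof.
move=> hR hc hd; pose t x (i : 'I_2) := if i == ord0 then c x else d x.
apply: (def_atom (t := t) hR); apply: dmap_dfun => i; rewrite /t.
by case: (i == ord0).
Qed.

Lemma def_eq1 n (c d : ('I_n -> M) -> M) :
  dfun S c -> dfun S d -> S (fun x => c x = d x).
Proof. by apply: def_rel2; apply: def_coord_eq. Qed.

Lemma dfun_comp n m (c : ('I_m -> M) -> M) (t : ('I_n -> M) -> ('I_m -> M)) :
  dfun S c -> dmap S t -> dfun S (fun x => c (t x)).
Proof. exact: dmap_comp. Qed.

Lemma dmap_if n m (P : pset M n) (t s : ('I_n -> M) -> ('I_m -> M)) :
  S P -> dmap S t -> dmap S s ->
  dmap S (fun x => cond (P x) (t x) (s x)).
Proof.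
move=> hP ht hs.
apply: (def_ext (A := fun z => (P (lpart z) /\ rpart z = t (lpart z)) \/
                              (~ P (lpart z) /\ rpart z = s (lpart z)))).
  by move=> z; rewrite /cond; case: excluded_middle_informative => h /=; tauto.
have hl : dmap S (@lpart M n m) by apply: (dmap_l (t := id)); apply: dmap_id.
have hr : dmap S (@rpart M n m) by apply: (dmap_r (t := id)); apply: dmap_id.
apply: def_or; apply: def_and.
- exact: def_atom.
- by apply: def_eq => //; apply: dmap_comp ht hl.
- by apply: def_not; exact: def_atom.
- by apply: def_eq => //; apply: dmap_comp hs hl.
Qed.

Lemma graph_onP n m (X : pset M n) (f : ('I_n -> M) -> ('I_m -> M)) :
  graph_on X f = (fun z => X (lpart z) /\ rpart z = f (lpart z)).
Proof.
apply: pset_ext => z; split=> [[x [hx ->]]|[hx e]].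
  by rewrite lpart_cat rpart_cat.
by exists (lpart z); rewrite -e cat_parts.
Qed.

Lemma def_graph_on n m (X : pset M n) (f : ('I_n -> M) -> ('I_m -> M)) :
  S X -> dmap S f -> S (graph_on X f).
Proof.
move=> hX hf; rewrite graph_onP; apply: def_and => //.
by apply: (def_atom hX); apply: (dmap_l (t := id)); apply: dmap_id.
Qed.

Lemma dmap_graph n m (f : ('I_n -> M) -> ('I_m -> M)) :
  S (graph_on (fun _ => True) f) -> dmap S f.
Proof. by rewrite graph_onP; apply: def_ext => z; tauto. Qed.

(** Uniqueness makes the graph of a choice function coincide with [R], so a function obtained by
    choice is definable. *)
Lemma dfun_rel n (R : ('I_n -> M) -> M -> Prop) :
  S (fun z : 'I_(n + 1) -> M => R (lpart z) (rpart z ord0)) ->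
  (forall x, exists y, R x y) -> (forall x y y', R x y -> R x y' -> y = y') ->
  exists c, dfun S c /\ forall x, R x (c x).
Proof.
move=> hR ex un; have [c hc] := choose_fun ex; exists c; split=> //.
apply: (def_ext _ hR) => z; split=> [h|->] //; apply: functional_extensionality => i.
by rewrite (ord1 i); apply: un (hc _).
Qed.

End Definability.

(** * Proofs of definability by the shape of a formula *)

Ltac dmap_tac :=
  cbv beta;
  lazymatch goal with
  | |- dmap ?S _ => match goal with HS : is_structure S |- _ =>
    first
    [ assumption
    | apply (dmap_const HS)
    | lazymatch goal with
      | |- dmap _ (fun x => x) => apply (dmap_id HS)
      | |- dmap _ (fun x => lpart (@?t x)) => apply (dmap_l HS (t := t)); dmap_tac
      | |- dmap _ (fun x => rpart (@?t x)) => apply (dmap_r HS (t := t)); dmap_tac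
      | |- dmap _ (fun x => cat_tup (@?t x) (@?s x)) =>
          apply (dmap_cat HS (t := t) (s := s)); dmap_tac
      | |- dmap _ (fun x => ?g (@?t x)) =>
          apply (dmap_comp HS (s := g) (t := t)); [assumption | dmap_tac]
      | |- dmap _ (fun x => _) => fail
      | |- dmap _ ?g => change (dmap S (fun x => g x)); dmap_tac
      end ] end
  | |- dfun ?S _ => match goal with HS : is_structure S |- _ =>
    first
    [ assumption
    | apply (dfun_const HS)
    | lazymatch goal with
      | |- dfun _ (fun x => ?c (@?t x)) =>
          apply (dfun_comp HS (c := c) (t := t)); [assumption | dmap_tac]
      end
    | apply (dfun_coord HS); dmap_tac ] end
  end.

(** Connectives and quantifiers are peeled off down to the atoms. With [sm_definable] among the
    hypotheses a smallness condition counts as one more quantifier, so that conditions on generic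
    points may occur in definitions. *)
Ltac definable :=
  cbv beta;
  lazymatch goal with
  | |- ?S ?n ?A => match goal with HS : @is_structure ?M S |- _ =>
    first
    [ assumption
    | apply (def_const HS)
    | lazymatch A with
      | (fun x => small ?dim (@?P x) ?k) =>
          match goal with H : sm_definable S dim |- _ => apply (H _ _ P k); definable end
      | (fun x => (@?P x) /\ (@?Q x)) => apply (def_and HS (A := P) (B := Q)); definable
      | (fun x => (@?P x) \/ (@?Q x)) => apply (def_or HS (A := P) (B := Q)); definable
      | (fun x => ~ (@?P x)) => apply (def_not HS (A := P)); definable
      | (fun x => exists y : 'I__ -> M, @?P x y) => apply (def_ex HS (A := P)); definable
      | (fun x => forall y : 'I__ -> M, @?P x y) => apply (def_all HS (A := P)); definable
      | (fun x => exists y, @?P x y) => apply (def_ex1 HS (A := P)); definable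
      | (fun x => forall i : 'I__, @?P x i) =>
          apply (def_fall HS (P := P)); let i := fresh "i" in intro i; definable
      | (fun x => forall y : M, @?P x y) => apply (def_all1 HS (A := P)); definable
      | (fun x => (@?P x) -> (@?Q x)) => apply (def_imp HS (A := P) (B := Q)); definable
      | (fun x => @eq ('I__ -> _) (@?t x) (@?s x)) =>
          apply (def_eq HS (t := t) (s := s)); dmap_tac
      | (fun x => @eq _ (@?c x) (@?d x)) =>
          apply (def_eq1 HS (c := c) (d := d)); dmap_tac
      | _ => match A with
        | (fun x => ?R (@?c x) (@?d x)) =>
            apply (def_rel2 HS (R := R) (c := c) (d := d)); [assumption | dmap_tac | dmap_tac]
        | (fun x => ?P (@?t x)) =>
            apply (def_atom HS (A := P) (t := t)); [definable | dmap_tac]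
        end
      end ] end
  end.
(** * Dimension *)

Section Dimension.

Context (M : Type) (lt : M -> M -> Prop).
Context (SL SN : forall n, pset M n -> Prop).
Context (dim : forall n, pset M n -> option nat).
Context (Hom : o_minimal lt SL) (HL : is_structure SL) (HN : is_structure SN).
Context (Hexp : forall n (A : pset M n), SL A -> SN A).
Context (Hdim : dim_compatible lt SL SN dim).

Local Notation sm := (small dim).

Lemma dmap_exp n m (t : ('I_n -> M) -> ('I_m -> M)) : dmap SL t -> dmap SN t.
Proof. exact: Hexp. Qed.

Lemma dim_None n (X : pset M n) : SN X -> (dim X = None <-> forall x, ~ X x).
Proof. by case: Hdim => [[_ [_ H]] _ _ _ _]; apply: H. Qed.

Lemma inhabited_univ : exists a : M, True.
Proof.
apply: NNPP => h; case: Hdim => [[_ [H _]] _ _ _ _].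
suff : dim (fun _ : 'I_1 -> M => True) = None by rewrite H.
apply/dim_None; first by definable.
by move=> x _; apply: h; exists (x ord0).
Qed.

Lemma sm_empty n (X : pset M n) k : (forall x, ~ X x) -> sm X k.
Proof.
move=> h; have -> : X = fun=> False by apply: pset_ext => x; split=> // /h.
have e : dim (fun _ : 'I_n -> M => False) = None.
  by apply/dim_None; [apply: (def_false HN) | move=> x []].
by rewrite /small e.
Qed.

Lemma sm0 n (X : pset M n) : SN X -> sm X 0 -> forall x, ~ X x.
Proof. by move=> hX; rewrite /small => h; apply/dim_None => //; case: (dim X) h. Qed.

Lemma sm_leq n (X : pset M n) a b : sm X a -> a <= b -> sm X b.
Proof. by rewrite /small; case: (dim X) => //= d; apply: leq_trans. Qed.

Lemma dim_union n (X Y : pset M n) : SN X -> SN Y ->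
  dim (fun x => X x \/ Y x) = dmax (dim X) (dim Y).
Proof. by case: Hdim => _ H _ _ _; apply: H. Qed.

Lemma sm_union n (X Y : pset M n) k : SN X -> SN Y ->
  sm X k -> sm Y k -> sm (fun x => X x \/ Y x) k.
Proof.
move=> hX hY; rewrite /small dim_union //.
by case: (dim X) => [a|] //; case: (dim Y) => [b|] //= ha hb; rewrite gtn_max ha.
Qed.

Lemma sm_sub n (X Y : pset M n) k : SN X -> SN Y ->
  (forall x, X x -> Y x) -> sm Y k -> sm X k.
Proof.
move=> hX hY XY; rewrite /small.
have -> : Y = fun x => X x \/ Y x by apply: pset_ext => x; split; [right | case=> // /XY].
rewrite dim_union //.
by case: (dim X) => [a|] //; case: (dim Y) => [b|] //=; rewrite gtn_max => /andP[].
Qed.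

Lemma sm_fin_union n (I : finType) (A : I -> pset M n) k : (forall i, SN (A i)) ->
  (forall i, sm (A i) k) -> sm (fun x => exists i, A i x) k.
Proof.
move=> hA sA.
have H (s : seq I) : SN (fun x => exists i, i \in s /\ A i x) /\
    sm (fun x => exists i, i \in s /\ A i x) k.
  elim: s => [|j s [IH1 IH2]].
    split; last by apply: sm_empty => x [i []].
    by apply: (def_ext _ (def_false HN n)) => x; split=> // -[i []].
  have -> : (fun x => exists i, i \in j :: s /\ A i x) =
            (fun x => A j x \/ exists i, i \in s /\ A i x).
    apply: pset_ext => x; split.
      by move=> [i []]; rewrite inE => /orP[/eqP-> |]; [left | right; exists i].
    case=> [hx|[i [hi hx]]]; first by exists j; rewrite inE eqxx.
    by exists i; rewrite inE hi orbT.
  by split; [apply: (def_or HN) | apply: sm_union].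
have [h1 h2] := H (enum I); apply: sm_sub h2 => //; first exact: (def_fex HN).
by move=> x [i hi]; exists i; rewrite mem_enum.
Qed.

Lemma dim_bij n m (X : pset M n) (Y : pset M m) (f : ('I_n -> M) -> ('I_m -> M)) :
  SN X -> dmap SN f -> (forall x, X x -> Y (f x)) ->
  (forall x x', X x -> X x' -> f x = f x' -> x = x') ->
  (forall y, Y y -> exists x, X x /\ f x = y) -> dim X = dim Y.
Proof.
move=> hX hf; case: Hdim => _ _ _ H _; apply: (H _ _ _ _ f).
exact: (def_graph_on HN).
Qed.

Lemma sm_inj n m (X : pset M n) (Y : pset M m) (f : ('I_n -> M) -> ('I_m -> M)) k :
  SN X -> SN Y -> dmap SN f -> (forall x, X x -> Y (f x)) ->
  (forall x x', X x -> X x' -> f x = f x' -> x = x') -> sm Y k -> sm X k.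
Proof.
move=> hX hY hf XY inj hk; rewrite /small.
rewrite (@dim_bij _ _ X (fun y => exists x, X x /\ f x = y) f) //; last by move=> x hx; exists x.
by apply: sm_sub hk => //; [definable | move=> y [x [hx <-]]; apply: XY].
Qed.

(* (D3) is stated for pairwise disjoint fibres only; replacing the fibre [X_t] by
   [{t} x X_t] removes this restriction. *)
Lemma dim_fibres p n (I : pset M p) (X : pset M (p + n)) : SN I -> SN X ->
  (forall d, SN (fun t => I t /\ dim (fun y => X (cat_tup t y)) = d)) /\
  (forall k, (forall t, I t -> dim (fun y => X (cat_tup t y)) = Some k) ->
     dim (fun z => I (lpart z) /\ X z) = dadd (dim I) k).
Proof.
move=> hI hX; case: Hdim => _ _ H _ _.
pose X' : pset M (p + (p + n)) := fun z => lpart z = lpart (rpart z) /\ X (rpart z).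
have hX' : SN X' by rewrite /X'; definable.
have fib t : dim (fun w => X' (cat_tup t w)) = dim (fun y => X (cat_tup t y)).
  symmetry; apply: (@dim_bij _ _ _ _ (fun y => cat_tup t y)).
  - by definable.
  - by dmap_tac.
  - by move=> y hy; rewrite /X' lpart_cat rpart_cat lpart_cat.
  - by move=> y y' _ _ /cat_inj[].
  - move=> w; rewrite /X' lpart_cat rpart_cat => -[e hw]; exists (rpart w).
    by rewrite e cat_parts.
have [] := H _ _ _ _ hI hX'.
  by move=> t t' y _ _; rewrite /X' !lpart_cat !rpart_cat => -[-> _] [->].
move=> h1 h2; split=> [d|k hk].
  by apply: (def_ext _ (h1 d)) => t; rewrite fib.
rewrite -(h2 k); last by move=> t ht; rewrite fib; apply: hk.
congr dim; apply: pset_ext => z; split.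
  by move=> [h hz]; exists (lpart z); rewrite /X' lpart_cat rpart_cat.
by move=> [t [ht]]; rewrite /X' lpart_cat rpart_cat => -[<-].
Qed.

(** * Definability of dimension, and dimension along fibres *)

Lemma def_dim n m (A : ('I_n -> M) -> pset M m) d :
  SN (fun z => A (lpart z) (rpart z)) -> SN (fun t => dim (A t) = d).
Proof.
move=> hA; have hT : SN (fun _ : 'I_n -> M => True) by definable.
apply: (def_ext _ ((dim_fibres hT hA).1 d)) => t.
have -> : (fun y => A (lpart (cat_tup t y)) (rpart (cat_tup t y))) = A t; last by tauto.
by apply: pset_ext => y; rewrite lpart_cat rpart_cat.
Qed.

(** A dimension below [k] is $-\infty$ or one of finitely many numbers, and each value is taken on a
    definable set by (D3)(a). *)
Lemma sm_definableN : sm_definable SN dim.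
Proof.
move=> n m A k hA.
apply: (def_ext (A := fun x => dim (A x) = None \/ ~ forall d : 'I_k, ~ dim (A x) = Some (val d))).
  move=> x; rewrite /small; case: (dim (A x)) => [d|] /=; last by split=> // _; left.
  split=> [[//|h]|h].
    by apply: NNPP => hd; apply: h => -[i hi] [e]; apply: hd; rewrite e.
  by right => h'; apply: (h' (Ordinal h)).
apply: (def_or HN) => //; first exact: def_dim.
apply: (def_not HN) => //; apply: (def_fall HN) => // d; apply: (def_not HN) => //; exact: def_dim.
Qed.

Lemma odim n (X : pset M n) : SL X -> is_odim lt X (dim X).
Proof. by case: Hdim => _ _ _ _ [H _]; apply: H. Qed.

Lemma incr_leq e n (f : 'I_e -> 'I_n) :
  (forall i j : 'I_e, i < j -> f i < f j) -> e <= n.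
Proof.
move=> hf; have inj : injective f.
  move=> i j e_f; apply: val_inj; case: (ltngtP i j) => // /hf; rewrite e_f ltnn //.
by have := leq_card f inj; rewrite !card_ord.
Qed.

Lemma sm_full n (X : pset M n) : SN X -> sm X n.+1.
Proof.
move=> hX; apply: (@sm_sub _ _ (fun=> True)) => //; first by definable.
have := @odim n (fun=> True); rewrite /small; case: (dim _) => //= d [].
  by definable.
by move=> [f [/incr_leq]].
Qed.

(** The base splits into finitely many definable sets [J d] on which the fibres have exact dimension
    [d], and (D3)(b) applies over each. The strict bound sits on the base; [b.+1] only says that the
    fibres have dimension at most [b]. *)
Lemma sm_fibres_up p n (I : pset M p) (X : pset M (p + n)) a b : SN I -> SN X ->
  (forall z, X z -> I (lpart z)) -> sm I a ->
  (forall t, I t -> sm (fun y => X (cat_tup t y)) b.+1) -> sm X (a + b).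
Proof.
move=> hI hX XI sI sX.
pose J d t := I t /\ dim (fun y => X (cat_tup t y)) = Some d.
have hJ d : SN (J d) by apply: (dim_fibres hI hX).1.
pose A d z := J d (lpart z) /\ X z.
have hA d : SN (A d) by have := hJ d; rewrite /A => ?; definable.
have h2 : SN (fun z => exists d : 'I_b.+1, A d z) by apply: (def_fex HN).
have h1 : sm (fun z => exists d : 'I_b.+1, A d z) (a + b).
  apply: sm_fin_union => // d.
  have e : dim (A d) = dadd (dim (J d)) d by apply: (dim_fibres (hJ d) hX).2 => t [].
  have : sm (J d) a by apply: sm_sub sI => // t [].
  rewrite /small e; case: (dim (J d)) => //= c hc.
  by rewrite -addSn; apply: leq_add => //; rewrite -ltnS ltn_ord.
apply: (sm_sub hX h2) h1 => z hz.
have := sX _ (XI _ hz); rewrite /small.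
case E : (dim (fun y => X (cat_tup (lpart z) y))) => [d|] /= hd.
  by exists (Ordinal hd); split=> //; split=> //; apply: XI.
have /dim_None h := E; case: (h _ (rpart z)); last by rewrite cat_parts.
by definable.
Qed.

(** Here the strict bound sits on the fibres. For [b = 0] all fibres are empty, and so is [X]. *)
Lemma sm_fibres_up' p n (I : pset M p) (X : pset M (p + n)) a b : SN I -> SN X ->
  (forall z, X z -> I (lpart z)) -> sm I a.+1 ->
  (forall t, I t -> sm (fun y => X (cat_tup t y)) b) -> sm X (a + b).
Proof.
case: b => [|b] hI hX XI sI sX; last by rewrite addnS -addSn; apply: (sm_fibres_up hI hX).
apply: sm_empty => z hz; have ht : SN (fun y => X (cat_tup (lpart z) y)) by definable.
by apply: (sm0 ht (sX _ (XI _ hz)) (x := rpart z)); rewrite cat_parts.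
Qed.

(** If the points with a fibre of dimension at least [b] had dimension [a] or more, then so would
    those with some exact fibre dimension [d] not below [b], and (D3)(b) would give [X] dimension at
    least [a + b]. *)
Lemma sm_fibres_low p n (X : pset M (p + n)) a b : SN X -> sm X (a + b) ->
  sm (fun t => ~ sm (fun y => X (cat_tup t y)) b) a.
Proof.
move=> hX sX.
have smN := sm_definableN.
pose J d t := b <= d /\ dim (fun y => X (cat_tup t y)) = Some d.
have hJ d : SN (J d).
  by apply: (def_and HN) => //; [exact: (def_const HN) | apply: def_dim; definable].
have h2 : SN (fun t => exists d : 'I_n.+1, J d t) by apply: (def_fex HN).
have h1 : sm (fun t => exists d : 'I_n.+1, J d t) a.
  apply: sm_fin_union => // d.
  have [hb|hb] := leqP b d; last by apply: sm_empty => t []; rewrite leqNgt hb.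
  have e := (dim_fibres (hJ d) hX).2 d (fun t h => proj2 h).
  have : sm (fun z => J d (lpart z) /\ X z) (a + b).
    by apply: sm_sub sX => //; [have := hJ d => ?; definable | move=> z []].
  rewrite /small e; case: (dim (J d)) => //= c hc.
  by rewrite -(ltn_add2r d); apply: leq_trans hc _; rewrite leq_add2l.
apply: sm_sub h1 => //; first by definable.
move=> t; rewrite /J.
have : sm (fun y => X (cat_tup t y)) n.+1 by apply: sm_full; definable.
rewrite /small; case: (dim _) => //= d hd /negP; rewrite -leqNgt => hb.
by exists (Ordinal hd).
Qed.

(** The graph [W], written with the value first, injects into [X]. Its nonempty fibres are those of
    dimension at least 0, so [sm_fibres_low] bounds the image. *)
Lemma sm_image_rel n m (X : pset M n) (R : ('I_n -> M) -> ('I_m -> M) -> Prop) k :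
  SN X -> SN (fun z => R (lpart z) (rpart z)) ->
  (forall x y y', X x -> R x y -> R x y' -> y = y') -> sm X k ->
  sm (fun y => exists x, X x /\ R x y) k.
Proof.
move=> hX hR fR sX; have smN := sm_definableN.
have hR2 p (u : ('I_p -> M) -> 'I_n -> M) (v : ('I_p -> M) -> 'I_m -> M) :
    dmap SN u -> dmap SN v -> SN (fun z => R (u z) (v z)).
  move=> hu hv; apply: (def_ext _ (def_atom HN hR (dmap_cat HN hu hv))) => z.
  by rewrite lpart_cat rpart_cat.
pose W (z : 'I_(m + n) -> M) := X (rpart z) /\ R (rpart z) (lpart z).
have hW : SN W by apply: (def_and HN); [definable | apply: hR2; dmap_tac].
have sW : sm W (k + 0).
  rewrite addn0; apply: (@sm_inj _ _ _ X (fun z => rpart z)) sX => //; first by dmap_tac.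
    by move=> z [].
  move=> z z' [hz1 hz2] [hz1' hz2'] e; rewrite -(cat_parts z) -(cat_parts z') e.
  by congr cat_tup; apply: (fR _ _ _ hz1' _ hz2'); rewrite -e.
apply: sm_sub (sm_fibres_low hW sW).
- by apply: (def_ex HN); apply: (def_and HN); [definable | apply: hR2; dmap_tac].
- by definable.
move=> y [x [hx hxy]] h; have hWy : SN (fun x => W (cat_tup y x)) by definable.
by apply: (sm0 hWy h (x := x)); rewrite /W lpart_cat rpart_cat.
Qed.

(** * Dimension in the o-minimal structure *)

Lemma def_lt : SL (fun x : 'I_2 -> M => lt (x ord0) (x ord_max)).
Proof. by case: Hom. Qed.

Lemma has_interiorP n (X : pset M n) : has_interior lt X <->
  exists a b, (exists y, in_box lt a b y) /\ forall y, in_box lt a b y -> X y.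
Proof.
split.
  move=> [U [oU [[x hx] UX]]]; have [a [b [hab h]]] := oU _ hx.
  by exists a, b; split=> [|y /h/UX]; first exists x.
move=> [a [b [hy h]]]; exists (in_box lt a b); split; last by split.
by move=> x hx; exists a, b.
Qed.

(** (D3)(a) only gives definability in $\mathcal N$. By (D5) the dimension is read off from boxes
    inside coordinate projections; boxes are given by their corners and there are finitely many
    projections, so the condition is $\mathcal L$-definable. *)
Lemma sm_definableL : sm_definable SL dim.
Proof.
move=> n m A k hA; have hlt := def_lt.
have slice x : SL (A x).
  apply: (def_ext (A := fun y => A (lpart (cat_tup x y)) (rpart (cat_tup x y)))).
    by move=> y; rewrite lpart_cat rpart_cat.
  by apply: (def_atom HL hA); dmap_tac.
(* Coordinate choices are finite functions, so that quantifying over them is a finite conjunction;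
   [e] stays below [m.+1] because an increasing choice takes at most [m] coordinates. *)
apply: (def_ext (A := fun x => forall (e : 'I_m.+1) (f : {ffun 'I_e -> 'I_m}),
   k <= e -> (forall i j : 'I_e, i < j -> f i < f j) ->
   ~ exists a b, (exists y, in_box lt a b y) /\
     forall y, in_box lt a b y -> proj_set f (A x) y)).
  move=> x; have := odim (slice x); rewrite /small.
  case: (dim (A x)) => [d|] /= hd; last first.
    split=> // _ e f _ _ /has_interiorP[U [_ [[y hy] UP]]].
    by have [z [/hd]] := UP _ hy.
  split=> [h|h e f ke hf /has_interiorP hint].
    have [[f [hf hint]] _] := hd; rewrite ltnNge; apply/negP => kd.
    have ltd : d < m.+1 by rewrite ltnS (incr_leq hf).
    apply: (h (Ordinal ltd) [ffun i => f i] kd).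
      by move=> i j; rewrite !ffunE; apply: hf.
    apply/has_interiorP; have -> // : [ffun i => f i] = f :> ('I_d -> 'I_m).
    by apply: functional_extensionality => i; rewrite ffunE.
  by have := proj2 hd _ _ hf hint; rewrite leqNgt (leq_trans h ke).
apply: (def_fall HL) => e; apply: (def_fall HL) => f.
have hA2 p (u : ('I_p -> M) -> 'I_n -> M) (v : ('I_p -> M) -> 'I_m -> M) :
    dmap SL u -> dmap SL v -> SL (fun z => A (u z) (v z)).
  move=> hu hv; apply: (def_ext _ (def_atom HL hA (dmap_cat HL hu hv))) => z.
  by rewrite lpart_cat rpart_cat.
rewrite /in_box /proj_set.
apply: (def_imp HL); first by definable.
apply: (def_imp HL); first by definable.
apply: (def_not HL); apply: (def_ex HL); apply: (def_ex HL); apply: (def_and HL).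
  by definable.
apply: (def_all HL); apply: (def_imp HL); first by definable.
apply: (def_ex HL); apply: (def_and HL); first by apply: hA2; dmap_tac.
by definable.
Qed.


Lemma dim_SomeP n (X : pset M n) d : SN X -> ~ sm X d -> sm X d.+1 -> dim X = Some d.
Proof.
rewrite /small; case: (dim X) => [e|] //= _ /negP; rewrite -leqNgt ltnS => h1 h2.
by congr Some; apply/eqP; rewrite eqn_leq h1 h2.
Qed.

Lemma gap_right (s : seq M) (y : M) :
  exists z, lt y z /\ forall p, List.In p s -> lt y p -> ~ lt p z.
Proof.
have [[irr tr tot dns ends] _ _ _] := Hom.
elim: s => [|p s [z [yz h]]].
  by have [_ [z yz]] := ends y; exists z.
case: (classic (lt y p /\ lt p z)) => [[yp pz]|hp].
  exists p; split=> // q [<- _|qs yq qp]; first exact: irr.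
  exact: (h q qs yq (tr _ _ _ qp pz)).
by exists z; split=> // q [<-|] *; [tauto | apply: h].
Qed.

Lemma interior_dim1 (A : pset M 1) a b x : SL A -> lt a x -> lt x b ->
  (forall v, lt a v -> lt v b -> A (fun=> v)) -> dim A = Some 1.
Proof.
move=> hA ax xb h; have hA' := Hexp hA.
have fun1 (v : 'I_1 -> M) : (fun=> v ord0) = v.
  by apply: functional_extensionality => i; rewrite (ord1 i).
apply: dim_SomeP => //; last exact: sm_full.
have := odim hA; rewrite /small; case: (dim A) => [d|] /=; last by move/(_ (fun=> x)) => hn; case: hn; apply: h.
move=> [_ /(_ 1 id)] hd /=; rewrite ltnS leqn0 => /eqP d0.
suff : 1 <= d by rewrite d0.
apply: hd => //; apply/has_interiorP; exists (fun=> a), (fun=> b); split.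
  by exists (fun=> x) => i.
move=> y hy; exists y; split=> //; rewrite -(fun1 y); apply: h; apply hy.
Qed.

(** A nonempty open interval inside [A] would give dimension 1, so by o-minimality [A] consists of
    finitely many points. *)
Lemma dim0_gap (A : pset M 1) (y : M) : SL A -> dim A = Some 0 ->
  exists z, lt y z /\ forall p, A (fun=> p) -> lt y p -> ~ lt p z.
Proof.
move=> hA A0; have [[irr tr tot dns ends] _ _ H] := Hom.
have [pts [ivs hAp]] := H _ hA; have [z [yz hz]] := gap_right pts y.
exists z; split=> // p /hAp[|[[l r] [hin [/= h1 h2]]]]; first exact: hz.
(* An infinite endpoint is replaced by a point of $M$ beside [p]. *)
have [a [ap ha]] : exists a, lt a p /\
    forall v, lt a v -> match l with Some a => lt a v | None => True end.
  case: l h1 {hin} => [a|_]; first by exists a.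
  by have [[a ?] _] := ends p; exists a.
have [b [pb hb]] : exists b, lt p b /\
    forall v, lt v b -> match r with Some b => lt v b | None => True end.
  case: r h2 {hin} => [b|_]; first by exists b.
  by have [_ [b ?]] := ends p; exists b.
suff : dim A = Some 1 by rewrite A0.
apply: (interior_dim1 hA ap pb) => v av vb; apply/hAp; right; exists (l, r).
by split=> //; split; [apply: ha | apply: hb].
Qed.

(** * Generic agreement with L-definable functions *)

(* [W] is the graph of a partial map from [M^N] to [M^n] all of whose fibres over [C]
   have the dimension [N - dim C] that a projection of [M^N] onto [C] would have. *)
Definition thick n (C : pset M n) := exists N r d (W : pset M (N + n)),
  [/\ SL C, SL W, (forall u c c', W (cat_tup u c) -> W (cat_tup u c') -> c = c'),
      (forall c, C c -> dim (fun u => W (cat_tup u c)) = Some r) &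
      dim C = Some d /\ N = d + r].

(** Finite unions are generated inductively, so that statements about thick sets extend by
    induction. The empty set is separate because a thick set has its dimension in $\mathbb N$. *)
Inductive covered n : pset M n -> Prop :=
| cov_empty C : (forall x, ~ C x) -> covered C
| cov_thick C : thick C -> covered C
| cov_union A B : covered A -> covered B -> covered (fun x => A x \/ B x).

Lemma covered_def n (C : pset M n) : covered C -> SL C.
Proof.
elim=> {C} [C hC|C|A B _ hA _ hB]; last exact: (def_or HL).
  by apply: (def_ext _ (def_false HL n)) => x; split=> // /hC.
by move=> [N [r [d [W []]]]].
Qed.

Lemma dim_over n (B : pset M n) (C : pset M (n + 1)) j d : SL B -> SL C ->
  (forall t, B t -> dim (fun y => C (cat_tup t y)) = Some j) -> dim B = Some d ->
  dim (fun z => B (lpart z) /\ C z) = Some (d + j).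
Proof.
move=> /Hexp hB /Hexp hC h e; have := dim_fibres hB hC.
by move=> [_ /(_ j h)] ->; rewrite e.
Qed.

(** The extra coordinate of the source becomes the last coordinate of the image point: [d] grows by
    one, and the fibres of the map keep dimension [r]. *)
Lemma thick_fibre1 n (B : pset M n) (C : pset M (n + 1)) : thick B -> SL C ->
  (forall t, B t -> dim (fun y => C (cat_tup t y)) = Some 1) ->
  thick (fun z => B (lpart z) /\ C z).
Proof.
move=> [N [r [d [W [hB hW fW rW [dB eN]]]]]] hC h1.
exists (N + 1), r, (d + 1), (fun z => W (cat_tup (lpart (lpart z)) (lpart (rpart z))) /\
  rpart (lpart z) = rpart (rpart z)); split.
- by definable.
- by definable.
- move=> u c c'; rewrite !lpart_cat !rpart_cat => -[h2 e2] [h3 e3].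
  by rewrite -(cat_parts c) -(cat_parts c') (fW _ _ _ h2 h3) -e2 e3.
- move=> c [hc _]; rewrite -(rW _ hc); symmetry.
  apply: (dim_bij (f := fun u => cat_tup u (rpart c))).
  + by apply: Hexp; definable.
  + by dmap_tac.
  + by move=> u hu; rewrite !lpart_cat !rpart_cat.
  + by move=> u u' _ _ /cat_inj[].
  + move=> u; rewrite !lpart_cat !rpart_cat => -[hu <-]; exists (lpart u).
    by rewrite cat_parts.
- by split; [apply: dim_over | rewrite eN addnAC].
Qed.

(* A point [(u, v)] of [M^N x M] is sent to [(t, y)], where [t] is the image of [u] and
   [y] is the largest element of the finite set [C_t] not exceeding [v]. *)
Lemma thick_fibre0 n (B : pset M n) (C : pset M (n + 1)) : thick B -> SL C ->
  (forall t, B t -> dim (fun y => C (cat_tup t y)) = Some 0) ->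
  thick (fun z => B (lpart z) /\ C z).
Proof.
move=> [N [r [d [W [hB hW fW rW [dB eN]]]]]] hC h0.
have hlt := def_lt; have [[irr tr tot dns ends] _ _ _] := Hom.
(* The extra coordinate is spent on the fibres: [d] stays and [r] grows by one. *)
exists (N + 1), (r + 1), (d + 0), (fun z => W (cat_tup (lpart (lpart z)) (lpart (rpart z))) /\
  (C (rpart z) /\ ~ lt (rpart (lpart z) ord0) (rpart (rpart z) ord0) /\
   forall y' : 'I_1 -> M, C (cat_tup (lpart (rpart z)) y') ->
     lt (rpart (rpart z) ord0) (y' ord0) -> lt (rpart (lpart z) ord0) (y' ord0))); split.
- by definable.
- by definable.
- move=> u c c'; rewrite !lpart_cat !rpart_cat => -[h2 [h3 [h4 h5]]] [h2' [h3' [h4' h5']]].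
  have e := fW _ _ _ h2 h2'.
  rewrite -(cat_parts c) -(cat_parts c') e; congr cat_tup.
  apply: functional_extensionality => i; rewrite (ord1 i).
  case: (tot (rpart c ord0) (rpart c' ord0)) => [hlt1|[//|hlt1]].
    by case: h4'; apply: h5 => //; rewrite e cat_parts.
  by case: h4; apply: h5' => //; rewrite -e cat_parts.
- move=> c [hc hCc].
  (* The fibre over [c] is the product of the old fibre over [lpart c] with [J]. The set [J] has
     dimension 1, because it contains the interval between the last coordinate of [c] and a point
     [z] with no element of the finite fibre strictly in between. *)
  pose J (v : 'I_1 -> M) := ~ lt (v ord0) (rpart c ord0) /\
   forall y' : 'I_1 -> M, C (cat_tup (lpart c) y') ->
     lt (rpart c ord0) (y' ord0) -> lt (v ord0) (y' ord0).
  have hJ : SL J by rewrite /J; definable.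
  have dJ : dim J = Some 1.
    have hCt : SL (fun y => C (cat_tup (lpart c) y)) by definable.
    have [z [yz hz]] := dim0_gap (rpart c ord0) hCt (h0 _ hc).
    have [x [yx xz]] := dns _ _ yz.
    apply: (interior_dim1 hJ yx xz) => v yv vz; split.
      by move=> vy; apply: (irr v); apply: tr yv.
    move=> y' hy' yy'.
    have ny'z : ~ lt (y' ord0) z.
      apply: hz => //; suff -> : (fun=> y' ord0) = y' by [].
      by apply: functional_extensionality => i; rewrite (ord1 i).
    case: (tot v (y' ord0)) => [//|[e|y'v]]; case: ny'z; first by rewrite -e.
    exact: tr vz.
  have hI : SN (fun u => W (cat_tup u (lpart c))) by apply: Hexp; definable.
  have hX : SN (fun z : 'I_(N + 1) -> M => J (rpart z)) by apply: Hexp; definable.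
  have [_ /(_ 1)] := dim_fibres hI hX; rewrite (rW _ hc) /= => <-.
    by congr dim; apply: pset_ext => z; rewrite !lpart_cat !rpart_cat /J; tauto.
  move=> t _; rewrite -dJ; congr dim; apply: pset_ext => y.
  by rewrite rpart_cat.
- by split; [apply: dim_over | rewrite eN addn0 addnA].
Qed.

Lemma covered_over n (B : pset M n) (C : pset M (n + 1)) : covered B ->
  (forall B', thick B' -> (forall t, B' t -> B t) -> thick (fun z => B' (lpart z) /\ C z)) ->
  covered (fun z => B (lpart z) /\ C z).
Proof.
elim=> {B} [B hB|B tB|A B _ IHA _ IHB] h.
- by apply: cov_empty => x [/hB].
- by apply: cov_thick; apply: h.
have -> : (fun z => (A (lpart z) \/ B (lpart z)) /\ C z) =
          (fun z => (A (lpart z) /\ C z) \/ (B (lpart z) /\ C z)).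
  by apply: pset_ext => z; tauto.
by apply: cov_union; [apply: IHA | apply: IHB] => B' hB' hs; apply: h => // t /hs; tauto.
Qed.

(** Fibres in the last coordinate have dimension $-\infty$, 0 or 1. By [sm_definableL] the base
    points of each kind form an $\mathcal L$-definable set, to which the induction hypothesis
    applies. *)
Lemma all_covered n (C : pset M n) : SL C -> covered C.
Proof.
have smL := sm_definableL.
elim: n C => [|n IH] C hC.
  case: (classic (exists x, C x)) => [[x hx]|hn]; last first.
    by apply: cov_empty => x hx; apply: hn; exists x.
  have e0 (u v : 'I_0 -> M) : u = v by apply: functional_extensionality => -[].
  have d0 (X : pset M 0) : SL X -> (exists x, X x) -> dim X = Some 0.
    move=> /Hexp hX [y hy]; apply: dim_SomeP => //; last exact: sm_full.
    by move=> h; apply: (sm0 hX h hy).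
  (* The identity of the one-point space $M^0$ is the covering map. *)
  apply: cov_thick; exists 0, 0, 0, (fun=> True); split=> //.
  - by definable.
  - by move=> c _; apply: d0; [definable | exists x].
  - by split=> //; apply: d0 => //; exists x.
move: C hC; rewrite -(addn1 n) => C hC.
pose B0 t := ~ sm (fun y => C (cat_tup t y)) 0 /\ sm (fun y => C (cat_tup t y)) 1.
pose B1 t := ~ sm (fun y => C (cat_tup t y)) 1.
have hB0 : SL B0 by rewrite /B0; definable.
have hB1 : SL B1 by rewrite /B1; definable.
have hCt t : SN (fun y => C (cat_tup t y)) by apply: Hexp; definable.
have -> : C = fun z => (B0 (lpart z) /\ C z) \/ (B1 (lpart z) /\ C z).
  apply: pset_ext => z; rewrite /B0 /B1; split; last by tauto.
  move=> hz; have : ~ sm (fun y => C (cat_tup (lpart z) y)) 0.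
    by move=> h; apply: (sm0 (hCt _) h (x := rpart z)); rewrite cat_parts.
  tauto.
apply: cov_union; apply: covered_over; try exact: IH.
  by move=> B' tB' hs; apply: thick_fibre0 => // t /hs[h1 h2]; apply: dim_SomeP.
move=> B' tB' hs; apply: thick_fibre1 => // t /hs h1; apply: dim_SomeP => //.
exact: sm_full.
Qed.

(** The pullback [ft] of [f] to $M^N$ is constant on each fibre of the covering map, and (D6)
    replaces it by [F] off a set [E] of dimension less than $N$. For most [c] the part of [E] in the
    fibre over [c] has dimension less than [r], and then [f c] is the only value that [F] takes on a
    part of dimension [r]. *)
Lemma thick_agree n (C : pset M n) (f : ('I_n -> M) -> M) d :
  thick C -> dim C = Some d -> dfun SN f ->
  exists F, dfun SL F /\ sm (fun c => C c /\ f c <> F c) d.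
Proof.
move=> [N [r [d' [W [hC hW fW rW [dC eN]]]]]] dC' hf.
have {d' dC} eN : N = d + r by move: dC; rewrite dC' => -[->].
have smL := sm_definableL; have smN := sm_definableN.
have hWN := Hexp hW; have hCN := Hexp hC.
have [a0 _] := inhabited_univ.
have [ft [hft ftP]] : exists ft, dfun SN ft /\ forall u,
    (exists c, W (cat_tup u c) /\ ft u = f c) \/ (~ (exists c, W (cat_tup u c)) /\ ft u = a0).
  apply: (dfun_rel (S := SN) (R := fun u v => (exists c, W (cat_tup u c) /\ v = f c) \/
      (~ (exists c, W (cat_tup u c)) /\ v = a0))).
  - by definable.
  - move=> u; case: (classic (exists c, W (cat_tup u c))) => [[c hc]|hn].
      by exists (f c); left; exists c.
    by exists a0; right.
  - move=> u v v' [[c [hc ->]]|[hn ->]] [[c' [hc' ->]]|[hn' ->]] //.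
    + by rewrite (fW _ _ _ hc hc').
    + by case: hn'; exists c.
    + by case: hn; exists c'.
have {}ftP u c : W (cat_tup u c) -> ft u = f c.
  move=> hc; case: (ftP u) => [[c' [hc' ->]]|[hn _]]; first by rewrite (fW _ _ _ hc hc').
  by case: hn; exists c.
have [F [E [hF [hE [sE FE]]]]] : exists F E, dfun SL F /\ SN E /\ sm E N /\
    forall u, ~ E u -> ft u = F u.
  case: Hdim => _ _ _ _ [_ H].
  have [|F [E [hF [hE [sE FE]]]]] := H N ft.
    by apply: (def_graph_on HN) => //; definable.
  by exists F, E; split=> //; apply: dmap_graph.
(* This is [E] laid out over [C]. Each [u] lies over at most one [c], so [V] injects into [E] and
   has dimension less than [d + r]. *)
pose V z := W (cat_tup (rpart z) (lpart z)) /\ E (rpart z).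
have hV : SN V by rewrite /V; definable.
have sV : sm V (d + r).
  rewrite -eN; apply: (sm_inj (f := fun z => rpart z) (Y := E)) => //.
  - by dmap_tac.
  - by move=> z [].
  - move=> z z' [h1 _] [h2 _] e; rewrite -(cat_parts z) -(cat_parts z') e.
    by congr cat_tup; apply: fW h1 _; rewrite e.
(* [F] takes the value [v] on a full-dimensional part of the fibre over [c]. An exceptional [c] may
   have several such [v] or none, hence the uniqueness in [U] and the default [a0]. *)
pose R c v := ~ sm (fun u => W (cat_tup u c) /\ F u = v) r.
pose U c v := R c v /\ forall v', R c v' -> v' = v.
have [F' [hF' F'P]] : exists F', dfun SL F' /\ forall c,
    U c (F' c) \/ (~ (exists v, U c v) /\ F' c = a0).
  apply: (dfun_rel (S := SL) (R := fun c v' => U c v' \/ (~ (exists v, U c v) /\ v' = a0))).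
  - by rewrite /U /R; definable.
  - move=> c; case: (classic (exists v, U c v)) => [[v hv]|hn].
      by exists v; left.
    by exists a0; right.
  - move=> c v v' [hv|[hn ->]] [hv'|[hn' ->]] //.
    + by apply: hv'.2; apply: hv.1.
    + by case: hn'; exists v.
    + by case: hn; exists v'.
have hFN := dmap_exp hF; have hFN' := dmap_exp hF'.
exists F'; split=> //.
apply: (sm_sub _ _ _ (sm_fibres_low hV sV)).
- by definable.
- by definable.
move=> c [hc ne] sV'; apply: ne.
have sWE : sm (fun u => W (cat_tup u c) /\ E u) r.
  suff <- : (fun u => V (cat_tup c u)) = fun u => W (cat_tup u c) /\ E u by [].
  by apply: pset_ext => u; rewrite /V lpart_cat rpart_cat.
have hR v : R c v <-> v = f c.
  split=> [hRv|-> hsm].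
    apply: NNPP => ne; suff : sm (fun u => W (cat_tup u c) /\ F u = v) r by exact: hRv.
    apply: sm_sub sWE; [by definable | by definable |].
    move=> u [hu ev]; split=> //; apply: NNPP => hEu; apply: ne.
    by rewrite -ev -(FE _ hEu) (ftP _ _ hu).
  suff : sm (fun u => W (cat_tup u c)) r by rewrite /small (rW _ hc) /= ltnn.
  apply: sm_sub (sm_union _ _ hsm sWE); try by definable.
  move=> u hu; case: (classic (E u)) => hEu; [by right | left; split=> //].
  by rewrite -(FE _ hEu) (ftP _ _ hu).
case: (F'P c) => [[/hR-> //]|[hn _]].
by case: hn; exists (f c); split; [apply/hR | move=> v' /hR].
Qed.


(* (D6) relative to an arbitrary [L]-definable set instead of [M^n]. *)
Lemma generic_agree n (C : pset M n) (f : ('I_n -> M) -> M) k :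
  SL C -> sm C k.+1 -> dfun SN f ->
  exists F, dfun SL F /\ sm (fun c => C c /\ f c <> F c) k.
Proof.
move=> hC sC hf; have := all_covered hC; move: sC {hC}.
move=> /[swap]; elim=> {C} [C hC|C tC|A B cA IHA cB IHB] sC.
- have [a0 _] := inhabited_univ; exists (fun=> a0); split.
    exact: (dfun_const HL).
  by apply: sm_empty => c [/hC].
- have [N [r [d [W [hC _ _ _ [dC _]]]]]] := tC.
  have [F [hF sF]] := thick_agree tC dC hf; exists F; split=> //.
  by apply: sm_leq sF _; move: sC; rewrite /small dC.
have hA := Hexp (covered_def cA); have hB := Hexp (covered_def cB).
have hAL := covered_def cA.
have hU : SN (fun x => A x \/ B x) by definable.
have [|F1 [hF1 sF1]] := IHA; first by apply: sm_sub sC => // x; left.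
have [|F2 [hF2 sF2]] := IHB; first by apply: sm_sub sC => // x; right.
have hF : dfun SL (fun x => cond (A x) (F1 x) (F2 x)).
  rewrite /dfun; have -> : (fun x (_ : 'I_1) => cond (A x) (F1 x) (F2 x)) =
      fun x => cond (A x) (fun=> F1 x) (fun=> F2 x); last exact: (dmap_if HL).
  by apply: functional_extensionality => x; rewrite /cond; case: excluded_middle_informative.
exists (fun x => cond (A x) (F1 x) (F2 x)); split=> //.
have hN1 := dmap_exp hF1; have hN2 := dmap_exp hF2; have hN := dmap_exp hF.
apply: sm_sub (sm_union _ _ sF1 sF2); try by definable.
move=> x [hx]; case: (classic (A x)) => hAx.
  by rewrite condT // => h; left.
by rewrite condF // => h; right; split=> //; case: hx.
Qed.

Lemma generic_agree_map n m (C : pset M n) (f : ('I_n -> M) -> ('I_m -> M)) k :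
  SL C -> sm C k.+1 -> dmap SN f ->
  exists F, dmap SL F /\ sm (fun c => C c /\ f c <> F c) k.
Proof.
move=> hC sC hf.
have hfi i : dfun SN (fun x => f x i) by dmap_tac.
have [F hF] := choose_fun (fun i => generic_agree hC sC (hfi i)).
exists (fun x i => F i x); have hFL i := (hF i).1.
have hFm : dmap SL (fun x i => F i x) by apply: (dmap_dfun HL).
split=> //; have hFN := dmap_exp hFm; have hCN := Hexp hC.
have hFiN i := dmap_exp (hFL i).
have hAi i : SN (fun c => C c /\ f c i <> F i c) by have := hFiN i => ?; definable.
apply: sm_sub (sm_fin_union hAi (fun i => (hF i).2)); first by definable.
  exact: (def_fex HN).
move=> c [hc ne]; apply: NNPP => h; apply: ne; apply: functional_extensionality => i.
by apply: NNPP => ne; apply: h; exists i.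
Qed.

(** * Closures of definable sets *)

Lemma def_cl n (X : pset M n) :
  (forall m (U : pset M m), SN U -> is_open lt U -> SL U) -> SN X -> SL (cl lt X).
Proof.
move=> Hopen hX; have hlt := Hexp def_lt.
have hcl : SN (cl lt X) by rewrite /cl /in_box; definable.
apply: (def_ext (A := fun x => ~ ~ cl lt X x)); first by move=> x; split; [apply: NNPP | tauto].
apply: (def_not HL); apply: Hopen; first by definable.
move=> x /not_all_ex_not[a /not_all_ex_not[b hab]].
have [hx hn] := imply_to_and _ _ hab.
by exists a, b; split=> // y hy /(_ a b hy).
Qed.

Lemma sub_cl n (X : pset M n) x : X x -> cl lt X x.
Proof. by move=> hx a b hab; exists x. Qed.

(** * The group chunk *)

Section GroupChunk.

Context (n k : nat) (G X0 : pset M n) (mu p : ('I_(n + n) -> M) -> ('I_n -> M)).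
Context (one : 'I_n -> M).

Local Notation "x ** y" := (mu (cat_tup x y)) (at level 40, left associativity).
Local Notation "x ## y" := (p (cat_tup x y)) (at level 40, left associativity).

Context (hG : SN G) (hmu : dmap SN mu) (hX0 : SL X0) (hp : dmap SL p).
Context (Gmul : forall x y, G x -> G y -> G (x ** y)).
Context (mulA : forall x y z, G x -> G y -> G z -> x ** y ** z = x ** (y ** z)).
Context (mul1 : forall x, G x -> one ** x = x /\ x ** one = x).
Context (Ginv : forall x, G x -> exists y, G y /\ x ** y = one /\ y ** x = one).
Context (sG : sm G k.+1) (nsG : ~ sm G k).
Context (sX0G : sm (fun x => X0 x /\ ~ G x) k) (sGX0 : sm (fun x => G x /\ ~ X0 x) k).
Context (smu : sm (fun z => (G (lpart z) /\ G (rpart z)) /\ mu z <> p z) (k + k)).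

Let smL : sm_definable SL dim := sm_definableL.
Let smN : sm_definable SN dim := sm_definableN.
Let hX0N : SN X0 := Hexp hX0.
Let hpN : dmap SN p := dmap_exp hp.

Lemma mul_cancelr a b u : G a -> G b -> G u -> a ** u = b ** u -> a = b.
Proof.
move=> ha hb hu e; have [v [hv [uv _]]] := Ginv hu.
by rewrite -(mul1 ha).2 -(mul1 hb).2 -uv -!mulA // e.
Qed.

Lemma mul_cancell a u v : G a -> G u -> G v -> a ** u = a ** v -> u = v.
Proof.
move=> ha hu hv e; have [b [hb [_ ba]]] := Ginv ha.
by rewrite -(mul1 hu).1 -(mul1 hv).1 -ba !mulA // e.
Qed.

(** * Generic points, good points and germs *)

Definition gen (P : pset M n) := sm (fun z => G z /\ ~ P z) k.

Lemma gen_and (P Q : pset M n) : SN P -> SN Q ->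
  gen P -> gen Q -> gen (fun z => P z /\ Q z).
Proof.
move=> hP hQ gP gQ; apply: sm_sub (sm_union _ _ gP gQ); try by definable.
by move=> x; tauto.
Qed.

Lemma gen_imp (P Q : pset M n) : SN P -> SN Q ->
  (forall z, G z -> P z -> Q z) -> gen P -> gen Q.
Proof.
move=> hP hQ PQ; apply: sm_sub; try by definable.
by move=> x [hx nQ]; split=> // /(PQ _ hx).
Qed.

Lemma gen_ex (P : pset M n) : SN P -> gen P -> exists z, G z /\ P z.
Proof.
move=> hP gP; apply: NNPP => h; apply: nsG; apply: sm_sub gP => //; first by definable.
by move=> z hz; split=> // hPz; apply: h; exists z.
Qed.

Lemma gen_transl (P : pset M n) g : SN P -> G g -> gen P -> gen (fun z => P (g ** z)).
Proof.
move=> hP hg; apply: (sm_inj (f := fun z => g ** z)); try by definable.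
- by dmap_tac.
- by move=> z [hz hPz]; split=> //; apply: Gmul.
- by move=> z z' [hz _] [hz' _]; apply: mul_cancell.
Qed.

(** Trading [G] for the $\mathcal L$-definable [X0] makes a generic condition written with [p] alone
    $\mathcal L$-definable. *)
Lemma genX0 (P : pset M n) : SN P -> (gen P <-> sm (fun z => X0 z /\ ~ P z) k).
Proof.
move=> hP; split=> h.
  by apply: sm_sub (sm_union _ _ h sX0G); try (by definable); move=> z; tauto.
by apply: sm_sub (sm_union _ _ h sGX0); try (by definable); move=> z; tauto.
Qed.

(** Since [G] and [mu] occur here, this set is definable in $\mathcal N$; it serves in proofs but
    not in the definition of the chunk. *)
Definition good x := [/\ X0 x, G x & gen (fun y => x ## y = x ** y)].

Lemma def_good : SN good.
Proof.
apply: (def_ext (A := fun x => X0 x /\ G x /\ gen (fun y => x ## y = x ** y))).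
  by move=> x; split=> [[? [? ?]]|[]].
by rewrite /gen; definable.
Qed.

Let hgood : SN good := def_good.

(** The disagreement of [mu] and [p] has dimension less than $2k$, so by [sm_fibres_low] only a
    small set of points has a fibre of dimension [k] or more in it. *)
Lemma gen_good : gen good.
Proof.
pose V (z : 'I_(n + n) -> M) := (G (lpart z) /\ G (rpart z)) /\ mu z <> p z.
have hV : SN V by rewrite /V; definable.
apply: sm_sub (sm_union _ _ sGX0 (sm_fibres_low hV smu)); try by definable.
move=> x [hx ng]; case: (classic (X0 x)) => [hx0|]; [right | by left].
move=> h; apply: ng; split=> //; apply: sm_sub h; try by definable.
by move=> y [hy ne]; rewrite /V lpart_cat rpart_cat; split=> // e; apply: ne.
Qed.

Lemma sm_notgood : sm (fun x => X0 x /\ ~ good x) k.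
Proof. by apply/genX0 => //; apply: gen_good. Qed.

Definition germ x g := G g /\ gen (fun u => x ## u = g ** u).

Lemma def_germ : SN (fun z : 'I_(n + n) -> M => germ (lpart z) (rpart z)).
Proof. by rewrite /germ /gen; definable. Qed.

Lemma germ_uniq x g g' : germ x g -> germ x g' -> g = g'.
Proof.
move=> [hg h] [hg' h']; have [|||u [hu [e e']]] := gen_ex _ (gen_and _ _ h h'); try by definable.
by apply: (mul_cancelr hg hg' hu); rewrite -e.
Qed.

Lemma germ_good x : good x -> germ x x.
Proof. by move=> []. Qed.

(* Says, in terms of [p] only, that [u |-> p (x, u)] is generically a left translation:
   [w] plays the role of the product of [x] and [y]. *)
Definition prechunk x := X0 x /\ sm (fun w => X0 w /\ ~ exists y, X0 y /\
  sm (fun z => X0 z /\ ~ (x ## (y ## z) = w ## z)) k) k.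

Lemma def_prechunk : SL prechunk.
Proof. by rewrite /prechunk; definable. Qed.

Let hprechunk : SL prechunk := def_prechunk.
Let hprechunkN : SN prechunk := Hexp hprechunk.

(** It suffices to find good [y] and [w] with [x ## (y ## z) = w ## z] for generic [z]: this reads
    $p(x,yz)=wz$, and the germ is $wy^{-1}$. *)
Lemma prechunk_germ x : prechunk x -> exists g, germ x g.
Proof.
move=> [hx sw].
pose R y w := X0 y /\ sm (fun z => X0 z /\ ~ (x ## (y ## z) = w ## z)) k.
have hR : SN (fun z => R (lpart z) (rpart z)) by rewrite /R; definable.
have gR y w : R y w -> gen (fun z => x ## (y ## z) = w ## z).
  by move=> [_ h]; apply/genX0 => //; definable.
have [y [w [gy gw hyw]]] : exists y w, [/\ good y, good w & R y w].
  (* Otherwise a generic good [w] is related only to points [y] that are not good. Among good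
     points, [w] is determined by [y], so these [w] form the image of a small set, and [G] would be
     small. *)
  apply: NNPP => hn; apply: nsG.
  pose D y := X0 y /\ ~ good y.
  have hD : SN D by rewrite /D; definable.
  pose R' y w := good w /\ R y w.
  have hR' : SN (fun z => R' (lpart z) (rpart z)) by rewrite /R' /R; definable.
  have sI : sm (fun w => exists y, D y /\ R' y w) k.
    apply: sm_image_rel => //; last exact: sm_notgood.
    move=> y w w' _ [[_ hw gw] /gR hyw] [[_ hw' gw'] /gR hyw'].
    have h1 := gen_and _ _ (gen_and _ _ gw gw') (gen_and _ _ hyw hyw').
    have [|||||||z [hz [[e1 e2] [e3 e4]]]] := gen_ex _ (h1 _ _ _ _ _ _); try by definable.
    by apply: (mul_cancelr hw hw' hz); rewrite -e1 -e2 -e3 -e4.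
  have hI : SN (fun w => exists y, D y /\ R' y w) by rewrite /D /R' /R; definable.
  have U := sm_union _ _ gen_good (sm_union _ _ sw sI).
  apply: sm_sub (U _ _ _ _) => //; try by definable.
  move=> w hw; case: (classic (good w)) => gw; last by left.
  right; have hw0 : X0 w by case: gw.
  case: (classic (exists y, R y w)) => [[y hyw]|nR]; last by left.
  right; exists y; split=> //; split; first by case: hyw.
  by move=> gy; apply: hn; exists y, w.
have [_ Gy hy] := gy; have [_ Gw hw] := gw; have [v [Gv [yv vy]]] := Ginv Gy.
exists (w ** v); split; first exact: Gmul.
have h1 := gen_and _ _ (gR _ _ hyw) (gen_and _ _ hy hw).
have h2 : gen (fun z => x ## (y ** z) = w ** z).
  apply: gen_imp (h1 _ _ _ _); try by definable.
  by move=> z hz [e1 [e2 e3]]; rewrite -e2 e1.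
(* Substitute $z=y^{-1}u$; left translation preserves genericity. *)
apply: gen_imp (gen_transl _ Gv h2); try by definable.
move=> u hu; rewrite -(mulA Gy Gv hu) yv (mul1 hu).1 => ->.
by rewrite mulA.
Qed.

(** For generic [w] the witness is $y=x^{-1}w$, which is good because translation preserves
    genericity; all three operations are then group products at generic [z]. *)
Lemma good_prechunk x : good x -> prechunk x.
Proof.
move=> gx; have [hx0 hx hxg] := gx; have [v [hv [xv vx]]] := Ginv hx; split=> //.
apply/genX0; first by definable.
have h1 := gen_and _ _ gen_good (gen_transl _ hv gen_good).
apply: gen_imp (h1 _ _ _); try by definable.
move=> w hw [gw gy]; exists (v ** w).
have [hw0 _ hwg] := gw; have [hy0 hy hyg] := gy; split=> //.
apply/genX0; first by definable.
have h2 := gen_and _ _ hyg (gen_and _ _ (gen_transl _ hy hxg) hwg).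
apply: gen_imp (h2 _ _ _ _ _); try by definable.
move=> z hz [-> [-> ->]].
by rewrite -mulA // -mulA // xv (mul1 hw).1.
Qed.

(* The points that share their germ with another point. *)
Definition dupl x := prechunk x /\ exists x', prechunk x' /\ x' <> x /\
  sm (fun z => X0 z /\ ~ (x ## z = x' ## z)) k.

Lemma def_dupl : SL dupl.
Proof. by rewrite /dupl; definable. Qed.

Let hdupl : SL dupl := def_dupl.
Let hduplN : SN dupl := Hexp hdupl.

(* A good [x] is its own germ, so if it is in [dupl] then it is the germ of some [x' <> x],
   which cannot be good; the germs of the points that are not good form a small set. *)
Lemma sm_dupl : sm dupl k.
Proof.
have hHN := def_germ.
have hD : SN (fun x => X0 x /\ ~ good x) by definable.
have sI : sm (fun y => exists x', (X0 x' /\ ~ good x') /\ germ x' y) k.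
  apply: sm_image_rel => //; last exact: sm_notgood.
  by move=> x y y' _; apply: germ_uniq.
apply: sm_sub (sm_union _ _ sm_notgood sI) => //; try by rewrite /germ /gen; definable.
move=> x [hx1 [x' [hx1' [ne hs]]]].
case: (classic (good x)) => gx; last by left; split=> //; case: hx1.
right; exists x'; have hH : germ x' x.
  have [_ hx hg] := gx; split=> //.
  have hs' : gen (fun z => x ## z = x' ## z) by apply/genX0 => //; definable.
  apply: gen_imp (gen_and _ _ hg hs'); try by definable.
  by move=> z _ [<- <-].
split=> //; split; first by case: hx1'.
by move=> /germ_good hH'; apply: ne; apply: germ_uniq hH.
Qed.

(** When several points share a germ all of them are dropped, instead of keeping a representative;
    this keeps the set $\mathcal L$-definable. *)
Definition chunk x := prechunk x /\ ~ dupl x.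

Lemma def_chunk : SL chunk.
Proof. by rewrite /chunk; definable. Qed.

Let hchunk : SL chunk := def_chunk.
Let hchunkN : SN chunk := Hexp hchunk.

(** * The injection into [G] and the multiplication of the chunk *)

Lemma germ_fun : exists h, dmap SN h /\ forall x, prechunk x -> germ x (h x).
Proof.
have hHN := def_germ.
(* The default [one] makes the map total, and uniqueness of germs makes its graph definable. *)
have ex x : exists g, (prechunk x /\ germ x g) \/ (~ prechunk x /\ g = one).
  case: (classic (prechunk x)) => hx; last by exists one; right.
  by have [g hg] := prechunk_germ hx; exists g; left.
have [h hh] := choose_fun ex; exists h; split; last by move=> x hx; case: (hh x) => -[].
apply: (def_ext (A := fun z => (prechunk (lpart z) /\ germ (lpart z) (rpart z)) \/
                              (~ prechunk (lpart z) /\ rpart z = one))).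
  move=> z; case: (hh (lpart z)) => -[hx hl]; split.
  - by case=> -[// _ hr]; apply: germ_uniq hr hl.
  - by move=> ->; left.
  - by case=> -[// _ ->].
  - by move=> ->; right.
by rewrite /germ /gen; definable.
Qed.

Lemma chunk_inj h x x' : (forall x, prechunk x -> germ x (h x)) -> chunk x -> chunk x' -> h x = h x' -> x = x'.
Proof.
move=> hh [hx nb] [hx' _] e; apply: NNPP => ne; apply: nb; split=> //; exists x'.
split=> //; split; first exact: not_eq_sym.
have [_ g1] := hh _ hx; have [_ g2] := hh _ hx'.
apply/genX0; first by definable.
apply: gen_imp (gen_and _ _ g1 g2); try by definable.
by move=> z _ [-> ->]; rewrite e.
Qed.

(** A good point outside [dupl] lies in the chunk and is its own germ, so [h] fixes it. *)
Lemma sm_not_germ_chunk h : (forall x, prechunk x -> germ x (h x)) -> dmap SN h ->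
  sm (fun g => G g /\ ~ exists x, chunk x /\ h x = g) k.
Proof.
move=> hh hhN; apply: sm_sub (sm_union _ _ gen_good sm_dupl) => //; try by definable.
move=> g [hg hn]; case: (classic (good g)) => gg; last by left.
right; apply: NNPP => nb; apply: hn; exists g; have hg1 := good_prechunk gg.
by split=> //; apply: germ_uniq (hh _ hg1) (germ_good gg).
Qed.

(** Where [p] leaves the chunk the left argument is the value, so that pairs from the chunk are
    always sent into it. *)
Definition chunk_mul z := cond (chunk (p z)) (p z) (lpart z).

Lemma dmap_chunk_mul : dmap SL chunk_mul.
Proof. by apply: (dmap_if HL) => //; [definable | dmap_tac]. Qed.

(** The last clause makes the germ of [p z] the product of the germs of the two entries, expressed
    by [X0] and [p] alone. *)
Definition chunk_dom z := chunk (lpart z) /\ chunk (rpart z) /\ chunk (p z) /\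
  sm (fun w => X0 w /\ ~ (lpart z ## (rpart z ## w) = p z ## w)) k.

Lemma def_chunk_dom : SL chunk_dom.
Proof. by rewrite /chunk_dom; definable. Qed.

Lemma chunk_dom_hom h x y : (forall x, prechunk x -> germ x (h x)) -> chunk_dom (cat_tup x y) ->
  h x ** h y = h (chunk_mul (cat_tup x y)).
Proof.
rewrite /chunk_dom /chunk_mul lpart_cat rpart_cat => hh [[hx _] [[hy _] [hc hs]]].
rewrite condT //; set c := x ## y in hc hs *.
have [Gx gx] := hh _ hx; have [Gy gy] := hh _ hy; have [Gc gc] := hh _ hc.1.
have hs' : gen (fun w => x ## (y ## w) = c ## w) by apply/genX0 => //; definable.
(* The germ of [x] is applied at [h y ** w], the generic value of [y ## w]; hence the translation by
   [h y]. *)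
have h1 := gen_and _ _ (gen_and _ _ hs' gy) (gen_and _ _ gc (gen_transl _ Gy gx)).
have [||||||||w [hw [[e1 e2] [e3 e4]]]] := gen_ex _ (h1 _ _ _ _ _ _ _); try by definable.
apply: (mul_cancelr (Gmul Gx Gy) Gc hw).
by rewrite mulA // -e4 -e2 e1 e3.
Qed.

(** Pairs with [x] not good lie over a base of dimension less than [k]. Over a good [x] the
    exceptional [y] have dimension less than [k], since for generic [y] both [y] and [x ** y] are
    good, [x ** y] is outside [dupl], and associativity in [G] gives the last clause of [chunk_dom].
    The two fibre bounds handle one case each. *)
Lemma sm_not_chunk_dom : sm (fun z => (chunk (lpart z) /\ chunk (rpart z)) /\ ~ chunk_dom z) (k + k).
Proof.
have hZ := Hexp def_chunk_dom.
have sX : sm chunk k.+1.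
  have sX0G' := sm_leq sX0G (leqnSn k).
  apply: sm_sub (sm_union _ _ sG sX0G') => //; try by definable.
  by move=> x [[hx _] _]; case: (classic (G x)); tauto.
have s1 : sm (fun z => (chunk (lpart z) /\ ~ good (lpart z)) /\ chunk (rpart z)) (k + k).
  apply: (sm_fibres_up (I := fun x => chunk x /\ ~ good x)); try by definable.
  - by move=> z [].
  - by apply: sm_sub sm_notgood; try (by definable); move=> x [[[hx _] _] ng].
  - move=> t _; apply: sm_sub sX => //; first by definable.
    by move=> y; rewrite lpart_cat rpart_cat => -[].
have s2 : sm (fun z => (chunk (lpart z) /\ good (lpart z)) /\ chunk (rpart z) /\ ~ chunk_dom z) (k + k).
  apply: (sm_fibres_up' (I := fun x => chunk x /\ good x)); try by definable.
  - by move=> z [].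
  - by apply: sm_sub sX; try (by definable); move=> x [].
  move=> x [hX_x gx]; have [_ hx hxg] := gx.
  have gnb : gen (fun y => ~ dupl y).
    by apply: sm_sub sm_dupl; try (by definable); move=> y [_ /NNPP].
  have h1 := gen_and _ _ (gen_and _ _ gen_good hxg)
    (gen_and _ _ (gen_transl _ hx gen_good) (gen_transl _ hx gnb)).
  have h2 : gen (fun y => (good y /\ x ## y = x ** y) /\ good (x ** y) /\ ~ dupl (x ** y)).
    by apply: h1; definable.
  move/genX0: h2 => h2; apply: sm_sub (h2 _); try by definable.
  move=> y; rewrite lpart_cat rpart_cat => -[_ [hX_y nZ]]; split; first by case: hX_y => -[].
  move=> [[gy exy] [gxy nb]]; apply: nZ; rewrite /chunk_dom lpart_cat rpart_cat exy.
  split=> //; split=> //; split; first by split=> //; apply: good_prechunk.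
  have [_ hy hyg] := gy; have [_ hxy hxyg] := gxy.
  apply/genX0; first by definable.
  have h3 := gen_and _ _ hyg (gen_and _ _ (gen_transl _ hy hxg) hxyg).
  apply: gen_imp (h3 _ _ _ _ _); try by definable.
  by move=> z hz [-> [-> ->]]; rewrite mulA.
apply: sm_sub (sm_union _ _ s1 s2); try by definable.
by move=> z; case: (classic (good (lpart z))); tauto.
Qed.

Lemma group_chunk : exists (X : pset M n) (Z : pset M (n + n)) h F,
  [/\ SL X /\ SL Z, (forall z, Z z -> X (lpart z) /\ X (rpart z)),
      sm (fun z => (X (lpart z) /\ X (rpart z)) /\ ~ Z z) (k + k) &
  [/\ dmap SN h, (forall x, X x -> G (h x)),
      (forall x x', X x -> X x' -> h x = h x' -> x = x'),
      sm (fun g => G g /\ ~ exists x, X x /\ h x = g) k &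
  [/\ dmap SL F, (forall z, X (lpart z) -> X (F z)) &
      forall x y, Z (cat_tup x y) -> h x ** h y = h (F (cat_tup x y))]]].
Proof.
have [h [hh germ_h]] := germ_fun.
exists chunk, chunk_dom, h, chunk_mul; split.
- by split; [exact: def_chunk | exact: def_chunk_dom].
- by move=> z [? []].
- exact: sm_not_chunk_dom.
split=> //.
- by move=> x [hx _]; case: (germ_h _ hx).
- by move=> x x'; apply: chunk_inj.
- exact: sm_not_germ_chunk.
split.
- exact: dmap_chunk_mul.
- move=> z hz; rewrite /chunk_mul; case: (classic (chunk (p z))) => hc.
    by rewrite condT.
  by rewrite condF.
- by move=> x y; apply: chunk_dom_hom.
Qed.

End GroupChunk.

End Dimension.

(** * Approximating [G] and its multiplication up to small sets *)

Theorem theorem5p1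
  (M : Type) (lt : M -> M -> Prop)
  (SL SN : forall n, pset M n -> Prop)
  (dim : forall n, pset M n -> option nat)
  (Hom : o_minimal lt SL)
  (HN : is_structure SN)
  (Hexp : forall n (A : pset M n), SL n A -> SN n A)
  (Hopen : forall n (U : pset M n), SN n U -> is_open lt U -> SL n U)
  (Hdim : dim_compatible lt SL SN dim)
  (n k : nat) (G : pset M n)
  (mul : ('I_n -> M) -> ('I_n -> M) -> ('I_n -> M)) (e : 'I_n -> M)
  (HGdef : SN n G)
  (Hmuldef : SN (n + n + n)
     (fun z => exists x y, G x /\ G y /\ z = cat_tup (cat_tup x y) (mul x y)))
  (Hclos : forall x y, G x -> G y -> G (mul x y))
  (Hassoc : forall x y z, G x -> G y -> G z -> mul (mul x y) z = mul x (mul y z))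
  (He : G e)
  (Hid : forall x, G x -> mul e x = x /\ mul x e = x)
  (Hinv : forall x, G x -> exists y, G y /\ mul x y = e /\ mul y x = e)
  (Hlarge : dim n G = dim n (cl lt G))
  (HdimG : dim n G = Some k) :
  exists (m : nat) (X : pset M m) (Z : pset M (m + m))
         (h : ('I_m -> M) -> ('I_n -> M))
         (F : ('I_(m + m) -> M) -> ('I_m -> M)),
    SL m X /\ SL (m + m) Z /\
        (forall x y, Z (cat_tup x y) -> X x /\ X y) /\
        (forall z, Z z -> exists x y, z = cat_tup x y) /\
        dlt (dim (m + m) (fun z => (exists x y, X x /\ X y /\ z = cat_tup x y) /\ ~ Z z))
            (2 * k) /\
        SN (m + n) (graph_on X h) /\
        (forall x, X x -> G (h x)) /\
        (forall x x', X x -> X x' -> h x = h x' -> x = x') /\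
        dlt (dim n (fun g => G g /\ ~ (exists x, X x /\ h x = g))) k /\
        SL (m + m + m) (graph_on (fun z => exists x y, X x /\ X y /\ z = cat_tup x y) F) /\
        (forall x y, X x -> X y -> X (F (cat_tup x y))) /\
        (forall x y, Z (cat_tup x y) -> mul (h x) (h y) = h (F (cat_tup x y))).
Proof.
have HL : is_structure SL by case: Hom.
have [a0 _] := inhabited_univ HN Hdim.
(* Two distinct elements code membership in [G] as the values of a function. *)
have [a [b nab]] : exists a b : M, a <> b.
  have [[irr _ _ _ ends] _ _ _] := Hom; have [_ [b a0b]] := ends a0.
  by exists a0, b => e0; apply: (irr b); rewrite -{1}e0.
pose C := cl lt G.
have hC : SL n C by apply: (def_cl Hom HL HN Hexp).
(* Strong largeness enters here. *)
have sC : small dim C k.+1 by rewrite /small -Hlarge HdimG /=.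
have hCN := Hexp _ _ hC; have hlG := @sub_cl M lt n G.
have hchi : dfun SN (fun x => cond (G x) a b).
  rewrite /dfun; have -> : (fun x (_ : 'I_1) => cond (G x) a b) =
      fun x => cond (G x) (fun=> a) (fun=> b).
    by apply: functional_extensionality => x; rewrite /cond; case: excluded_middle_informative.
  by apply: (dmap_if HN) => //; apply: (dmap_const HN).
have [chi [hchiL schi]] := generic_agree Hom HL HN Hexp Hdim hC sC hchi.
have hchiN := dmap_exp Hexp hchiL.
(* Inside [C], which contains [G], this set differs from [G] only where [chi] differs from the
   characteristic function. *)
pose X0 x := C x /\ chi x = a.
have hX0 : SL n X0 by rewrite /X0; definable.
have hX0N := Hexp _ _ hX0.
have sX0G : small dim (fun x => X0 x /\ ~ G x) k.
  apply: (sm_sub Hdim) schi; try by definable.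
  by move=> x [[hx e0] nG]; rewrite condF // e0; split=> // /esym.
have sGX0 : small dim (fun x => G x /\ ~ X0 x) k.
  apply: (sm_sub Hdim) schi; try by definable.
  move=> x [hx nX]; have hCx := hlG _ hx; rewrite condT //; split=> // e0.
  by apply: nX.
(* The value [e] off $G\times G$ makes the product a total definable map, as the approximation lemma
   requires. *)
pose mu z := cond (G (lpart z) /\ G (rpart z)) (mul (lpart z) (rpart z)) e.
have muE x y : G x -> G y -> mu (cat_tup x y) = mul x y.
  by move=> hx hy; rewrite /mu lpart_cat rpart_cat condT.
have hmu : dmap SN mu.
  apply: (def_ext (A := fun z => (exists x y, G x /\ G y /\ z = cat_tup (cat_tup x y) (mul x y)) \/
    (~ (G (lpart (lpart z)) /\ G (rpart (lpart z))) /\ rpart z = e))); last by definable.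
  move=> z; rewrite /mu; case: (classic (G (lpart (lpart z)) /\ G (rpart (lpart z)))) => hz.
    rewrite condT //; split=> [[[x [y [hx [hy ->]]]]|[]] //|e0].
      by rewrite !lpart_cat !rpart_cat.
    left; exists (lpart (lpart z)), (rpart (lpart z)); rewrite -e0 !cat_parts.
    by case: hz.
  rewrite condF //; split=> [[[x [y [hx [hy e0]]]]|[]] //|]; last by right.
  by case: hz; rewrite e0 !lpart_cat !rpart_cat.
pose CC z := C (lpart z) /\ C (rpart z).
have hCC : SL (n + n) CC by rewrite /CC; definable.
have hCCN := Hexp _ _ hCC.
(* The base has dimension below [k.+1] and the fibres at most [k], which add up to a bound below
   [k.+1 + k]. *)
have sCC : small dim CC (k + k).+1.
  rewrite -addSn; apply: (sm_fibres_up HN Hdim hCN hCCN _ sC); first by move=> z [].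
  move=> t _; apply: (sm_sub Hdim) sC => //; first by definable.
  by move=> y; rewrite /CC rpart_cat => -[].
have [p [hp smu]] := generic_agree_map Hom HL HN Hexp Hdim hCC sCC hmu.
have hpN := dmap_exp Hexp hp.
have {}smu : small dim (fun z => (G (lpart z) /\ G (rpart z)) /\ mu z <> p z) (k + k).
  apply: (sm_sub Hdim) smu; try by definable.
  by move=> z [[h1 h2] ne]; split=> //; split; apply: hlG.
have Gmul x y : G x -> G y -> G (mu (cat_tup x y)) by move=> hx hy; rewrite muE //; apply: Hclos.
have mulA x y z : G x -> G y -> G z ->
    mu (cat_tup (mu (cat_tup x y)) z) = mu (cat_tup x (mu (cat_tup y z))).
  by move=> hx hy hz; rewrite !muE //; [apply: Hassoc | apply: Hclos | apply: Hclos].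
have mul1 x : G x -> mu (cat_tup e x) = x /\ mu (cat_tup x e) = x.
  by move=> hx; rewrite !muE //; apply: Hid.
have Ginv x : G x -> exists y, G y /\ mu (cat_tup x y) = e /\ mu (cat_tup y x) = e.
  by move=> hx; have [y [hy h]] := Hinv _ hx; exists y; rewrite !muE.
have sG : small dim G k.+1 by rewrite /small HdimG /=.
have nsG : ~ small dim G k by rewrite /small HdimG /= ltnn.
have [X [Z [h [F [[hX hZ] ZX sZ [hh Gh h_inj sh [hF XF hom]]]]]]] :=
  group_chunk Hom HL HN Hexp Hdim HGdef hmu hX0 hp Gmul mulA mul1 Ginv sG nsG sX0G sGX0 smu.
have prodP z : (exists x y, X x /\ X y /\ z = cat_tup x y) <-> X (lpart z) /\ X (rpart z).
  split=> [[x [y [hx [hy ->]]]]|[hx hy]].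
    by rewrite lpart_cat rpart_cat.
  by exists (lpart z), (rpart z); rewrite cat_parts.
exists n, X, Z, h, F; split=> //; split=> //; split.
  by move=> x y /ZX; rewrite lpart_cat rpart_cat.
split; first by move=> z _; exists (lpart z), (rpart z); rewrite cat_parts.
split.
  have -> : (fun z => (exists x y, X x /\ X y /\ z = cat_tup x y) /\ ~ Z z) =
      fun z => (X (lpart z) /\ X (rpart z)) /\ ~ Z z.
    by apply: pset_ext => z; have := prodP z; tauto.
  by rewrite mul2n -addnn.
split; first by apply: (def_graph_on HN) => //; apply: Hexp.
do 3!split=> //; split; first by rewrite (pset_ext prodP); apply: (def_graph_on HL) => //; definable.
split; first by move=> x y hx hy; apply: XF; rewrite lpart_cat.
move=> x y hxy; have := ZX _ hxy; rewrite lpart_cat rpart_cat => -[hx hy].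
by rewrite -hom // muE //; apply: Gh.
Qed.
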